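(* Let $k$ be a field and let $d,m$ be integers with $d$ odd and $5\le d<m-1$. Set $a=(d+1)/2$, let $R=k[x_1,\dots,x_m,z_1,z_2]$ with all variables of degree $1$, and let $I=(I_{a,2,m-1},\, x_1x_mI_{a-1,3,m-2})$ and $J=(I_{a-1,2,m-2},\, z_1z_2 I_{a-2,3,m-3})$ be ideals of $R$ (so $I\subset J$). Let $\phi\in\operatorname{Hom}_{R/I}(J,R/I)$ be the unique homomorphism with $\phi(v)=0$ for all $v\in I_{a-1,2,m-2}$ and $\phi(z_1z_2w)=x_1x_{m-1}x_mw$ for all $w\in I_{a-2,3,m-3}$ (such $\phi$ exists, and $\operatorname{Hom}_{R/I}(J,R/I)$ is generated by $\phi$ and the inclusion). Let \[ S=\frac{(R/I)[T]}{(Tu-\phi(u)\mid u\in J)}, \] graded with $\deg T=1$. Then $z_1,z_2$ is an $S$-regular sequence, and there is an isomorphism of graded $k$-algebras $S/(z_1,z_2)\cong k[\Delta(d,m+1)]$.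
   Context: For positive integers $a,p,q$ with $p<q$ and $2a\le q-p+2$, $I_{a,p,q}$ denotes the ideal (of any polynomial ring containing $x_p,\dots,x_q$) generated by all monomials $x_{t_1}\cdots x_{t_a}$ with $p\le t_1$, $t_a\le q$ and $t_j+2\le t_{j+1}$ for $1\le j\le a-1$. For integers $2\le d<n$, $\Delta(d,n)$ denotes the boundary simplicial complex of the $d$-dimensional cyclic polytope with $n$ vertices, the convex hull in $\mathbb{R}^d$ of $f(t_1),\dots,f(t_n)$ with $t_1<\dots<t_n$ real and $f(t)=(t,\dots,t^d)$, vertex $i$ corresponding to $f(t_i)$; faces are $\emptyset$ and vertex sets of proper faces. $k[\Delta]$ is the standard graded Stanley–Reisner ring $k[x_1,\dots,x_n]/I_\Delta$, $I_\Delta$ generated by the squarefree monomials $\prod_{t\in W}x_t$ with $W\notin\Delta$. *)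

(* Defs.v *)
From HB Require Import structures.
From mathcomp Require Import all_boot all_order all_algebra.
From mathcomp Require Import reals.
From mathcomp Require Import mpoly.
Set Implicit Arguments. Unset Strict Implicit. Unset Printing Implicit Defensive.
Import Order.TTheory GRing.Theory Num.Theory.
Local Open Scope ring_scope.

Definition in_ideal {T : comNzRingType} (G : T -> Prop) (f : T) : Prop :=
  exists s : seq (T * T), (forall q, q \in s -> G q.2) /\
                          f = \sum_(q <- s) q.1 * q.2.

Definition gen_union {T : eqType} (G : T -> Prop) (xs : seq T) : T -> Prop :=
  fun f => G f \/ f \in xs.

Definition Igen {T : comNzRingType} (x : nat -> T) (a p q : nat) (f : T) : Prop :=
  exists t : seq nat,
    [/\ size t = a, sorted (fun i j => i.+2 <= j)%N t,
        all (fun i => p <= i <= q)%N t & f = \prod_(i <- t) x i].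

Definition Igens {T : comNzRingType} (x : nat -> T) (a m : nat) (f : T) : Prop :=
  Igen x a 2 m.-1 f \/
  exists w, Igen x a.-1 3 m.-2 w /\ f = x 1%N * x m * w.

Definition Jgens {T : comNzRingType} (x : nat -> T) (z1 z2 : T) (a m : nat)
    (f : T) : Prop :=
  Igen x a.-1 2 m.-2 f \/
  exists w, Igen x a.-2 3 (m - 3)%N w /\ f = z1 * z2 * w.

(* phi_rel u p : u is an element of J and p is a representative (in R) of
   phi(u mod I) in R/I, where phi is the R/I-linear map with phi(v) = 0 for
   v in I_{a-1,2,m-2} and phi(z1 z2 w) = x_1 x_{m-1} x_m w for w in
   I_{a-2,3,m-3}: u = sum r_i v_i + sum s_j z1 z2 w_j + (element of I),
   p = sum s_j x_1 x_{m-1} x_m w_j. *)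
Definition phi_rel {T : comNzRingType} (x : nat -> T) (z1 z2 : T) (a m : nat)
    (u p : T) : Prop :=
  exists (rs ss : seq (T * T)) (iota : T),
    [/\ (forall q, q \in rs -> Igen x a.-1 2 m.-2 q.2),
        (forall q, q \in ss -> Igen x a.-2 3 (m - 3)%N q.2),
        in_ideal (Igens x a m) iota,
        u = \sum_(q <- rs) q.1 * q.2 + \sum_(q <- ss) q.1 * (z1 * z2 * q.2) + iota
      & p = \sum_(q <- ss) q.1 * (x 1%N * x m.-1 * x m * q.2)].

(* The ring R = k[x_1..x_m, z_1, z_2] is {mpoly k[m.+2]}:
   x_i = 'X_(i-1) (1 <= i <= m), z_1 = 'X_m, z_2 = 'X_(m+1). *)
Definition xR (k : fieldType) (m i : nat) : {mpoly k[m.+2]} := 'X_(inord i.-1).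
Definition z1R (k : fieldType) (m : nat) : {mpoly k[m.+2]} := 'X_(inord m).
Definition z2R (k : fieldType) (m : nat) : {mpoly k[m.+2]} := 'X_(inord m.+1).

(* The ring R[T] = k[x_1..x_m, z_1, z_2, T] is {mpoly k[m.+3]}, same
   variables and T = 'X_(m+2). *)
Definition xP (k : fieldType) (m i : nat) : {mpoly k[m.+3]} := 'X_(inord i.-1).
Definition z1P (k : fieldType) (m : nat) : {mpoly k[m.+3]} := 'X_(inord m).
Definition z2P (k : fieldType) (m : nat) : {mpoly k[m.+3]} := 'X_(inord m.+1).
Definition TP (k : fieldType) (m : nat) : {mpoly k[m.+3]} := 'X_(inord m.+2).

Definition embRP (k : fieldType) (m : nat) (p : {mpoly k[m.+2]}) : {mpoly k[m.+3]} :=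
  p \mPo [tuple 'X_(widen_ord (leqnSn m.+2) i) | i < m.+2].

(* S = (R/I)[T] / (T u - phi(u) | u in J) = k[x,z,T] / L, where L is the
   ideal of k[x,z,T] generated by the following elements. *)
Definition Sgens (k : fieldType) (a m : nat) (f : {mpoly k[m.+3]}) : Prop :=
  Igens (xP k m) a m f \/
  exists u p, phi_rel (xR k m) (z1R k m) (z2R k m) a m u p /\
              f = TP k m * embRP u - embRP p.

Definition regular_seq {T : comNzRingType} (G : T -> Prop) (xs : seq T) : Prop :=
  (forall i, (i < size xs)%N -> forall f : T,
      in_ideal (gen_union G (take i xs)) (nth 0 xs i * f) ->
      in_ideal (gen_union G (take i xs)) f) /\
  ~ in_ideal (gen_union G xs) 1.

Definition linform {k : fieldType} {n : nat} (p : {mpoly k[n]}) : bool :=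
  all (fun mo => mdeg mo == 1%N) (msupp p).

(* Isomorphism of standard graded k-algebras k[X_1..X_p]/(GA) and
   k[Y_1..Y_q]/(GB): graded k-algebra maps in both directions (determined by
   the degree-1 images of the variables, lifted to linear forms), which are
   well defined on the quotients and mutually inverse. *)
Definition graded_iso {k : fieldType} {p q : nat}
    (GA : {mpoly k[p]} -> Prop) (GB : {mpoly k[q]} -> Prop) : Prop :=
  exists (f : p.-tuple {mpoly k[q]}) (g : q.-tuple {mpoly k[p]}),
    [/\ (forall i, linform (tnth f i)) /\ (forall j, linform (tnth g j)),
        (forall h, in_ideal GA h -> in_ideal GB (h \mPo f)),
        (forall h, in_ideal GB h -> in_ideal GA (h \mPo g)),
        (forall i : 'I_p, in_ideal GA ('X_i - (tnth f i \mPo g)))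
      & (forall j : 'I_q, in_ideal GB ('X_j - (tnth g j \mPo f)))].

(* Boundary complex of the cyclic polytope Delta(d,n) with vertices
   f(t_0),...,f(t_{n-1}), f(t) = (t, t^2, ..., t^d); vertex i : 'I_n stands
   for f(t_i).  W is a face iff W is empty or W is the vertex set of a proper
   face, i.e. W = {i | c.f(t_i) = b} for a supporting hyperplane c.y <= b of
   the polytope, with W not all vertices. *)
Definition cyc_face (R : realType) (d n : nat) (t : 'I_n -> R) (W : {set 'I_n}) : Prop :=
  W = set0 \/
  exists (c : 'I_d -> R) (b : R),
    [/\ (forall i, \sum_(j < d) c j * t i ^+ j.+1 <= b),
        W = [set i | \sum_(j < d) c j * t i ^+ j.+1 == b]
      & W != setT].

Definition SRgens (k : fieldType) (R : realType) (d n : nat) (t : 'I_n -> R)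
    (f : {mpoly k[n]}) : Prop :=
  exists W : {set 'I_n}, ~ cyc_face d t W /\ f = \prod_(i in W) 'X_i.

(* Main.v *)
Require Import Defs.
From HB Require Import structures.
From mathcomp Require Import all_boot all_order all_algebra.
From mathcomp Require Import reals.
From mathcomp Require Import mpoly.
From mathcomp Require Import boolp.
From mathcomp Require Import zify ring.
Import Order.TTheory GRing.Theory Num.Theory.
Set Implicit Arguments. Unset Strict Implicit. Unset Printing Implicit Defensive.
Local Open Scope ring_scope.

(* All ideals are governed by supports of monomials: a monomial avoids [I]
   exactly when its support is a face, i.e. has no [a] pairwise nonadjacent
   elements in [2, m-1] and, if it contains [1] and [m], no [a-1] such elements
   in [3, m-2]. Write [y = x_1 x_(m-1) x_m], [V = I_(a-1,2,m-2)] and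
   [K = I_(a-2,3,m-3)], so that [J = V + z_1 z_2 K].

   Hom: if [psi(g)] has a nonzero coefficient at a face [mu] not containing
   [i], for some [i] in a generator [g], then a generator [g'] avoiding [i]
   with [mu + g'] a face contradicts [g' psi(g) = g psi(g')]. So [psi(v)] is a
   multiple of each generator [v] of [V], and the cofactors agree because
   generators compatible with a given face are connected by chains of jointly
   compatible ones. Subtracting [alpha] times the inclusion, [psi] kills [V],
   and the same argument makes [psi(z_1 z_2 w)] a multiple of [y w].

   Regularity: the ideal of [S] is [M + (T z_1 z_2 - y) K], with [M = I + T V]
   monomial and free of [z_1]. That [z_1] is regular modulo it comes down to
   [M : y] being contained in [M : T]. Modulo [z_1] the ideal is the monomial
   ideal [M + y K], which is also free of [z_2].

   Isomorphism: sending [x_m] to the last vertex, [T] to the one before it and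
   [z_1, z_2] to [0] matches [M + y K] with the nonfaces of the cyclic polytope.
   A set is a face of the polytope iff a polynomial of degree at most
   [d = 2a-1] is nonnegative on the parameters and vanishes exactly on it;
   products of [(X - t_i)(X - t_(i+1))] and boundary factors provide such
   polynomials, and the vanishing of the top divided difference excludes
   them for nonfaces. *)

(** * Spread sequences *)

Local Open Scope nat_scope.

Definition spread : rel nat := fun i j => i.+2 <= j.

Definition within (p q : nat) : pred nat := fun i => p <= i <= q.

Definition spread_seq (n p q : nat) (t : seq nat) : bool :=
  [&& size t == n, pairwise spread t & all (within p q) t].

Lemma spread_trans : transitive spread.
Proof. by move=> y x z; rewrite /spread; lia. Qed.

Lemma size_spread_seq n p q t : spread_seq n p q t -> size t = n.
Proof. by case/and3P => /eqP. Qed.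

Lemma spread_seq_within n p q t i : spread_seq n p q t -> i \in t -> p <= i <= q.
Proof. by case/and3P => _ _ /allP t_in /t_in. Qed.

Lemma spread_seq_notin n p q t i :
  spread_seq n p q t -> ~~ within p q i -> (i \in t) = false.
Proof. by move=> t_spread; apply: contraNF; apply: spread_seq_within t_spread. Qed.

Lemma spread_seq_uniq n p q t : spread_seq n p q t -> uniq t.
Proof. by case/and3P => _ + _; apply: pairwise_uniq => i; rewrite /spread; lia. Qed.

Lemma spread_seq_widen n p q p' q' t :
  spread_seq n p q t -> p' <= p -> q <= q' -> spread_seq n p' q' t.
Proof.
case/and3P => sz_t t_spread t_in le_p le_q; rewrite /spread_seq sz_t t_spread /=.
by apply: sub_all t_in => i; rewrite /within; lia.
Qed.

Lemma spread_seq_all_within n p q p' q' t :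
  spread_seq n p q t -> p' <= p -> q <= q' -> all (within p' q') t.
Proof. by move=> t_spread le_p le_q; case/and3P: (spread_seq_widen t_spread le_p le_q). Qed.

Lemma spread_seq_cons n p q i t :
  spread_seq n.+1 p q (i :: t) = within p q i && spread_seq n i.+2 q t.
Proof.
rewrite /spread_seq /= eqSS.
apply/and3P/and3P => [[-> /andP[/allP it ->] /andP[-> /allP t_in]]|[i_in -> ]].
  by split=> //; apply/allP => j jt; have := it j jt; have := t_in j jt;
     rewrite /spread /within; lia.
case/andP=> t_spread /allP t_in; rewrite t_spread i_in /= andbT; split=> //;
  by apply/allP => j /t_in; move: i_in; rewrite /spread /within; lia.
Qed.

Lemma spread_seq_rcons n p q i t : 0 < p ->
  spread_seq n.+1 p q (rcons t i) = within p q i && spread_seq n p (i - 2) t.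
Proof.
move=> p_gt0; rewrite /spread_seq size_rcons eqSS pairwise_rcons all_rcons.
apply/and3P/and3P => [[-> /andP[/allP ti ->] /andP[-> /allP t_in]]|[i_in -> ]].
  by split=> //; apply/allP => j jt; have := ti j jt; have := t_in j jt;
     rewrite /spread /within; lia.
case/andP=> t_spread /allP t_in; rewrite t_spread i_in /= andbT; split=> //;
  by apply/allP => j /t_in; move: i_in; rewrite /spread /within; lia.
Qed.

Lemma spread_seq_cat n p q s t : spread_seq n p q (s ++ t) =
  [&& size s + size t == n, spread_seq (size s) p q s, spread_seq (size t) p q t
    & allrel spread s t].
Proof.
rewrite /spread_seq size_cat pairwise_cat all_cat !eqxx /=.
by case: (_ == n); case: (allrel _ _ _); case: (pairwise _ s); case: (pairwise _ t);
   rewrite ?andbF ?andbT.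
Qed.

Lemma cat_spread_seq n1 n2 p q p' q' s t : spread_seq n1 p q s -> spread_seq n2 p' q' t ->
  q.+2 <= p' -> p <= p' -> q <= q' -> spread_seq (n1 + n2) p q' (s ++ t).
Proof.
move=> s_spread t_spread gap le_p le_q; rewrite spread_seq_cat.
rewrite (size_spread_seq s_spread) (size_spread_seq t_spread) eqxx /=.
rewrite (spread_seq_widen s_spread) // (spread_seq_widen t_spread) //=.
apply/allrelP => i j /(spread_seq_within s_spread) + /(spread_seq_within t_spread).
by rewrite /spread; lia.
Qed.

Fixpoint nspread_rec (W : pred nat) (len p : nat) : nat :=
  if len is len1.+1 then
    if W p then (if len1 is len2.+1 then nspread_rec W len2 p.+2 else 0).+1
    else nspread_rec W len1 p.+1
  else 0.

(* The largest size of a spread sequence in [W] between [p] and [q], found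
   greedily from the left. *)
Definition nspread (W : pred nat) (p q : nat) : nat := nspread_rec W (q.+1 - p) p.

Lemma nspread_left (W : pred nat) p q : p <= q ->
  nspread W p q = if W p then (nspread W p.+2 q).+1 else nspread W p.+1 q.
Proof.
move=> le_pq; rewrite /nspread.
have -> : q.+1 - p = (q - p).+1 by lia.
rewrite [in LHS]/=; case: ifP => _; last by congr nspread_rec; lia.
congr _.+1; have -> : q.+1 - p.+2 = (q - p).-1 by lia.
by case: (q - p).
Qed.

Lemma nspread_gt (W : pred nat) p q : q < p -> nspread W p q = 0.
Proof. by move=> lt_qp; rewrite /nspread; have -> : q.+1 - p = 0 by lia. Qed.

Lemma left_end_ind (P : nat -> Prop) (q : nat) :
  (forall p, q < p -> P p) ->
  (forall p, p <= q -> P p.+1 -> P p.+2 -> P p) -> forall p, P p.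
Proof.
move=> P_gt P_le p; have [n] := ubnP (q.+1 - p).
elim: n p => // n IHn p lt_n.
have [lt_qp|le_pq] := ltnP q p; first exact: P_gt.
by apply: P_le => //; apply: IHn; lia.
Qed.

Lemma nspread_geP (W : pred nat) p q n :
  reflect (exists2 t, spread_seq n p q t & all W t) (n <= nspread W p q).
Proof.
apply: (iffP idP) => [|[t]].
  move: p n; apply: (left_end_ind (q := q)) => [p lt_qp|p le_pq IHp1 IHp2] n.
    by rewrite nspread_gt // leqn0 => /eqP ->; exists [::].
  case: n => [|n]; first by exists [::].
  rewrite nspread_left //; case: ifP => [Wp /IHp2[t t_spread Wt]|_ /IHp1[t t_spread Wt]].
    by exists (p :: t) => /=; rewrite ?Wp // spread_seq_cons t_spread /within leqnn le_pq.
  by exists t => //; apply: spread_seq_widen t_spread _ _.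
move: p n t; apply: (left_end_ind (q := q)) => [p lt_qp|p le_pq IHp1 IHp2] [|n] //.
  move=> [|i t] // ; rewrite spread_seq_cons /within; lia.
move=> [|i t] //; rewrite spread_seq_cons => /andP[i_in t_spread] /= /andP[Wi Wt].
rewrite nspread_left //; case: ifP => Wp.
  by apply: IHp2 Wt; apply: spread_seq_widen t_spread _ _ => //; move: i_in; rewrite /within; lia.
have ne_ip : i != p by apply: contraFneq Wp => <-.
apply: (IHp1 _ (i :: t)); last by rewrite /= Wi.
by rewrite spread_seq_cons t_spread andbT; move: i_in ne_ip; rewrite /within; lia.
Qed.

Lemma nspread_witness (W : pred nat) p q :
  exists2 t, spread_seq (nspread W p q) p q t & all W t.
Proof. exact/nspread_geP. Qed.

Lemma leq_nspread (W W' : pred nat) p q p' q' :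
  (forall i, within p q i -> W i -> within p' q' i && W' i) ->
  nspread W p q <= nspread W' p' q'.
Proof.
move=> sub; have [t t_spread /allP Wt] := nspread_witness W p q.
have /and3P[sz_t sp_t /allP t_in] := t_spread.
apply/nspread_geP; exists t; rewrite /spread_seq ?sz_t ?sp_t;
  by apply/allP => i it; have /andP[] := sub i (t_in i it) (Wt i it).
Qed.

Lemma leq_nspread_wide (W : pred nat) p q p' q' :
  p' <= p -> q <= q' -> nspread W p q <= nspread W p' q'.
Proof.
by move=> le_p le_q; apply: leq_nspread => i i_in ->; move: i_in; rewrite /within; lia.
Qed.

Lemma eq_nspread (W W' : pred nat) p q : (forall i, within p q i -> W i = W' i) ->
  nspread W p q = nspread W' p q.
Proof.
move=> eqW; apply/eqP; rewrite eqn_leq.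
by apply/andP; split; apply: leq_nspread => i i_in; rewrite i_in eqW.
Qed.

Lemma nspread_pred0 p q : nspread pred0 p q = 0.
Proof. by have [[|i t] /size_spread_seq <- //] := nspread_witness pred0 p q. Qed.

Lemma nspread_split (W : pred nat) p i q :
  nspread W p q <= nspread W p i + nspread W i.+1 q.
Proof.
have [t /and3P[/eqP <- sp_t /allP t_in] /allP Wt] := nspread_witness W p q.
have size_part (a : pred nat) p' q' : {in t, forall j, a j -> within p' q' j} ->
    count a t <= nspread W p' q'.
  move=> a_in; rewrite -size_filter; apply/nspread_geP; exists (filter a t).
    rewrite /spread_seq eqxx (subseq_pairwise (filter_subseq _ _) sp_t) /=.
    by apply/allP => j; rewrite mem_filter => /andP[aj /a_in]; apply.
  by apply/allP => j; rewrite mem_filter => /andP[_ /Wt].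
rewrite -(count_predC (fun j => j <= i) t).
by apply: leq_add; apply: size_part => j /t_in; rewrite /within /=; lia.
Qed.

Lemma nspread_splitN (W : pred nat) p i q : 0 < i -> ~~ W i ->
  nspread W p q <= nspread W p i.-1 + nspread W i.+1 q.
Proof.
move=> i_gt0 Wi; apply: leq_trans (nspread_split W p i.-1 q) _.
rewrite prednK // leq_add2l; apply: leq_nspread => j j_in Wj; rewrite Wj andbT.
by have : j != i by [apply: contraNneq Wi => <-]; move: j_in; rewrite /within; lia.
Qed.

Lemma nspread_gap (W : pred nat) p i j q : i.+2 <= j -> p <= j -> i <= q ->
  nspread W p i + nspread W j q <= nspread W p q.
Proof.
move=> gap le_pj le_iq.
have [s s_spread Ws] := nspread_witness W p i.
have [t t_spread Wt] := nspread_witness W j q.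
apply/nspread_geP; exists (s ++ t); last by rewrite all_cat Ws.
exact: cat_spread_seq s_spread t_spread _ _ _.
Qed.

Lemma nspread_double_leq (W : pred nat) p q : (nspread W p q).*2 <= q.+2 - p.
Proof.
move: p; apply: (left_end_ind (q := q)) => [p lt_qp|p le_pq IHp1 IHp2].
  by rewrite nspread_gt.
by rewrite nspread_left //; case: ifP => _; lia.
Qed.

Lemma spread_seq_double_leq n p q t : spread_seq n p q t -> n.*2 <= q.+2 - p.
Proof.
move=> t_spread; apply: leq_trans (nspread_double_leq predT p q).
by rewrite leq_double; apply/nspread_geP; exists t => //; apply/allP.
Qed.

Lemma nspread_full (W : pred nat) p q : (forall i, within p q i -> W i) ->
  q.+1 - p <= (nspread W p q).*2.
Proof.
move: p; apply: (left_end_ind (q := q)) => [p lt_qp|p le_pq _ IHp2] Wall.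
  by rewrite nspread_gt //; lia.
rewrite nspread_left // Wall; last by rewrite /within; lia.
have: q.+1 - p.+2 <= (nspread W p.+2 q).*2.
  by apply: IHp2 => i i_in; apply: Wall; move: i_in; rewrite /within; lia.
by lia.
Qed.

Lemma nspread_short (W : pred nat) p q : q <= p.+1 -> nspread W p q <= 1.
Proof. by have := nspread_double_leq W p q; lia. Qed.

Lemma nspread_leftS (W : pred nat) p q : nspread W p q <= (nspread W p.+1 q).+1.
Proof.
apply: leq_trans (nspread_split W p p q) _.
by rewrite -[leqRHS]add1n leq_add2r nspread_short.
Qed.

Lemma nspread_rightS (W : pred nat) p q : nspread W p q <= (nspread W p q.-1).+1.
Proof.
apply: leq_trans (nspread_split W p q.-1 q) _.
by rewrite -[leqRHS]addn1 leq_add2l nspread_short // -ltnS; lia.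
Qed.

Lemma spread_seq_cat_cons n p q s i t : spread_seq n p q (s ++ i :: t) ->
  spread_seq (size s) p (i - 2) s /\ spread_seq (size t) i.+2 q t.
Proof.
rewrite spread_seq_cat /= => /and4P[_ s_spread it_spread /allrelP si].
split; last by move: it_spread; rewrite spread_seq_cons => /andP[].
case/and3P: s_spread => _ sp_s /allP s_in; rewrite /spread_seq eqxx sp_s /=.
apply/allP => j j_s; have := s_in j j_s; have := si j i j_s (mem_head _ _).
by rewrite /within /spread; lia.
Qed.

Lemma nspread_predU1 (W : pred nat) p i q :
  nspread (predU1 i W) p q <=
  maxn (nspread W p q) (nspread W p (i - 2) + nspread W i.+2 q).+1.
Proof.
have [t t_spread /allP Wt] := nspread_witness (predU1 i W) p q.
have Wj j : j \in t -> j != i -> W j by move=> /Wt /predU1P[->|//]; rewrite eqxx.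
rewrite leq_max; apply/orP; have [it|it] := boolP (i \in t); last first.
  left; apply/nspread_geP; exists t => //.
  by apply/allP => j jt; apply: Wj => //; apply: contraNneq it => <-.
right; rewrite -(size_spread_seq t_spread).
case/splitPr: it t_spread Wj {Wt} => t1 t2 t_spread Wj.
have [t1_spread t2_spread] := spread_seq_cat_cons t_spread.
have /andP[i_out _] : uniq (i :: t2 ++ t1).
  by rewrite -cat_cons uniq_catC (spread_seq_uniq t_spread).
have W_part t' : {subset t' <= t2 ++ t1} -> all W t'.
  move=> sub; apply/allP => j /sub j_t; apply: Wj; last by apply: contraNneq i_out => <-.
  by move: j_t; rewrite !mem_cat inE orbC => /orP[]->; rewrite ?orbT.
rewrite size_cat /= addnS ltnS; apply: leq_add; apply/nspread_geP.
  by exists t1 => //; apply: W_part => j; rewrite mem_cat orbC => ->.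
by exists t2 => //; apply: W_part => j; rewrite mem_cat => ->.
Qed.

Definition adjoin (W : pred nat) (t : seq nat) : pred nat := predU W (mem t).

Lemma adjoin_out (W : pred nat) n p q t i :
  spread_seq n p q t -> ~~ within p q i -> adjoin W t i = W i.
Proof. by move=> t_spread i_out; rewrite /adjoin /= (spread_seq_notin t_spread) ?orbF. Qed.

Lemma nspread_adjoin_out (W : pred nat) t n p q p' q' :
  spread_seq n p' q' t -> (q < p') || (q' < p) ->
  nspread (adjoin W t) p q = nspread W p q.
Proof.
move=> t_spread disj; apply: eq_nspread => i i_in; apply: adjoin_out t_spread _.
by move: i_in; rewrite /within; lia.
Qed.

Lemma nspread_adjoin_cat (W : pred nat) s t p q :
  nspread (adjoin W (s ++ t)) p q = nspread (adjoin (adjoin W s) t) p q.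
Proof. by apply: eq_nspread => i _; rewrite /adjoin /= mem_cat orbA. Qed.

(* Taking [b = false] or [b = true] leaves out the last or the first element of
   the interval. *)
Lemma nspread_extend (W : pred nat) (b : bool) n p q :
  nspread W p q <= n -> n.*2 <= q.+1 - p ->
  exists2 t, spread_seq n (p + b) (q + b).-1 t & nspread (adjoin W t) p q <= n.
Proof.
move: p n; apply: (left_end_ind (q := q)) => [p lt_qp|p le_pq IHp1 IHp2] n le_n room.
  exists [::]; last by rewrite nspread_gt.
  by have -> : n = 0 by lia.
have [n0|n_gt0] := posnP n.
  rewrite {}n0 in le_n room *; exists [::] => //; apply: leq_trans le_n.
  by apply: leq_nspread => i ->; rewrite /adjoin /= orbF.
have [take_p|skip_p] := boolP (W p || (q.+1 - p == n.*2)).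
  have [||t t_spread le_t] := IHp2 n.-1; [|by lia|].
    case/orP: take_p => [Wp|/eqP tight]; first by move: le_n; rewrite nspread_left // Wp; lia.
    by have := nspread_double_leq W p.+2 q; lia.
  exists ((p + b) :: t).
    rewrite -(prednK n_gt0) spread_seq_cons; apply/andP; split; first by rewrite /within; lia.
    exact: t_spread.
  apply: leq_trans (nspread_split _ p p.+1 q) _; rewrite -(prednK n_gt0) -[leqRHS]add1n.
  apply: leq_add; first exact: nspread_short.
  apply: leq_trans le_t; apply: leq_nspread => i i_in; rewrite i_in /adjoin /= inE.
  by have -> : (i == p + b) = false by move: i_in; rewrite /within; lia.
move: skip_p; rewrite negb_or => /andP[Wp loose].
have [||t t_spread le_t] := IHp1 n; [by move: le_n; rewrite nspread_left // (negPf Wp)|by lia|].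
exists t; first by apply: spread_seq_widen t_spread _ _; lia.
apply: leq_trans le_t; rewrite nspread_left // ifN //.
by rewrite (adjoin_out _ t_spread) // /within; lia.
Qed.

Lemma nspread_extend_around (W : pred nat) p i q n : 0 < p -> ~~ W i ->
  nspread W p i.-1 + nspread W i.+1 q <= n -> (nspread W p i.-1).*2 + p <= i ->
  (nspread W i.+1 q).*2 + i <= q -> n.*2 + p < q ->
  exists t, [/\ i \notin t, spread_seq n p.+1 q.-1 t & nspread (adjoin W t) p q <= n].
Proof.
move=> p_gt0 Wi le_n room_l room_r room.
have [nl [nr [def_n ge_l fit_l ge_r fit_r]]] : exists nl nr,
    [/\ nl + nr = n, nspread W p i.-1 <= nl, nl.*2 <= i - p,
         nspread W i.+1 q <= nr & nr.*2 <= q - i].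
  pose nl := minn (n - nspread W i.+1 q) (i - p)./2.
  by exists nl, (n - nl); rewrite /nl; split; lia.
have [|tl tl_spread le_l] := @nspread_extend W true nl p i.-1 ge_l; first lia.
have [|tr tr_spread le_r] := @nspread_extend W false nr i.+1 q ge_r; first lia.
have {}tl_spread : spread_seq nl p.+1 i.-1 tl by apply: spread_seq_widen tl_spread _ _; lia.
have {}tr_spread : spread_seq nr i.+1 q.-1 tr by apply: spread_seq_widen tr_spread _ _; lia.
have i_out : i \notin tl ++ tr.
  by rewrite mem_cat (spread_seq_notin tl_spread) ?(spread_seq_notin tr_spread) // /within; lia.
exists (tl ++ tr); split=> //.
  by rewrite -def_n; apply: cat_spread_seq tl_spread tr_spread _ _ _; lia.
apply: leq_trans (@nspread_splitN _ p i q _ _) _; first lia.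
  by rewrite /adjoin /= negb_or Wi.
rewrite -def_n; apply: leq_add.
  by rewrite nspread_adjoin_cat (nspread_adjoin_out _ tr_spread) //; lia.
apply: leq_trans le_r; apply: leq_nspread => j j_in.
rewrite j_in /adjoin /= mem_cat (spread_seq_notin tl_spread) //.
by move: j_in; rewrite /within; lia.
Qed.

(* By [in_face_ideal] below, the monomials outside [I] are those whose support
   is a face. *)
Definition face (a m : nat) (W : pred nat) : bool :=
  (nspread W 2 m.-1 < a) && (W 1 && W m ==> (nspread W 3 m.-2 < a.-1)).

Definition min_nonface (a m : nat) (s : seq nat) : Prop :=
  spread_seq a 2 m.-1 s \/ exists2 t, spread_seq a.-1 3 m.-2 t & s = [:: 1; m] ++ t.

Lemma min_nonface_uniq a m s : 1 < m -> min_nonface a m s -> uniq s.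
Proof.
move=> m_gt1 [s_spread|[t t_spread ->]]; first exact: spread_seq_uniq s_spread.
rewrite /= inE !(spread_seq_notin t_spread) /within ?(spread_seq_uniq t_spread); lia.
Qed.

Lemma min_nonface_within a m s : 1 < m -> min_nonface a m s -> all (within 1 m) s.
Proof.
move=> m_gt1 [s_spread|[t t_spread ->]].
  by apply: spread_seq_all_within s_spread _ _; rewrite ?leq_pred.
by rewrite all_cat (spread_seq_all_within t_spread) //= /within; lia.
Qed.

Lemma nonfaceP a m (W : pred nat) :
  ~~ face a m W <-> exists2 s, min_nonface a m s & all W s.
Proof.
rewrite /face negb_and negb_imply -!leqNgt; split.
  case/orP => [/nspread_geP[t t_spread Wt]|/andP[W1m /nspread_geP[t t_spread Wt]]].
    by exists t => //; left.
  by exists ([:: 1; m] ++ t); [right; exists t|rewrite /= andbA W1m].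
case=> s [s_spread|[t t_spread ->]] Ws; apply/orP; [left|right].
  by apply/nspread_geP; exists s.
move: Ws; rewrite /= andbA => /andP[-> Wt].
by apply/nspread_geP; exists t.
Qed.

Lemma face_sub a m (W W' : pred nat) : 0 < m ->
  (forall i, within 1 m i -> W i -> W' i) -> face a m W' -> face a m W.
Proof.
move=> m_gt0 sub /andP[lt_from2 lt_from3].
have le_W p q : 1 <= p -> q <= m -> nspread W p q <= nspread W' p q.
  move=> p_ge1 q_le; apply: leq_nspread => i i_in Wi; rewrite i_in sub //.
  by move: i_in; rewrite /within; lia.
apply/andP; split; first by apply: leq_ltn_trans lt_from2; apply: le_W; lia.
apply/implyP => /andP[W1 Wm]; apply: (@leq_ltn_trans (nspread W' 3 m.-2)).
  by apply: le_W; lia.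
by apply: (implyP lt_from3); rewrite !sub // /within; lia.
Qed.

Lemma eq_face a m (W W' : pred nat) : 0 < m ->
  (forall i, within 1 m i -> W i = W' i) -> face a m W = face a m W'.
Proof. by move=> m_gt0 eqW; apply/idP/idP; apply: face_sub => // i /eqW ->. Qed.

Lemma face_adjoin_cat a m (W : pred nat) s t :
  face a m (adjoin W (s ++ t)) = face a m (adjoin (adjoin W s) t).
Proof. by rewrite /face !nspread_adjoin_cat /adjoin /= !mem_cat !orbA. Qed.

Lemma face_small a m (W : pred nat) :
  nspread W 2 m.-1 < a -> nspread W 3 m.-2 < a.-1 -> face a m W.
Proof. by rewrite /face => -> ->; rewrite implybT. Qed.

Lemma nspread_adjoin_cons2 (W : pred nat) n q t :
  nspread (adjoin W t) 3 q <= n -> nspread (adjoin W (2 :: t)) 3 q <= n.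
Proof.
move/(leq_trans _); apply; apply: leq_nspread => i i_in.
by rewrite i_in /adjoin /= inE; have -> : (i == 2) = false by move: i_in; rewrite /within; lia.
Qed.

Lemma nonface_nspread a m (W : pred nat) : ~~ face a m W -> a.-1 <= nspread W 2 m.-2.
Proof.
rewrite /face negb_and negb_imply -!leqNgt => /orP[le_a|/andP[_ le_a]].
  by have := nspread_rightS W 2 m.-1; lia.
by apply: leq_trans le_a _; apply: leq_nspread_wide.
Qed.

Section Faces.
Variables (a m : nat).
Hypotheses (a_ge3 : 3 <= a) (m_gt : a.*2 < m).

Lemma face_1m_missing (W : pred nat) : W 1 -> W m -> face a m W ->
  exists2 i, within 3 m.-2 i & ~~ W i.
Proof.
move=> W1 Wm /andP[_]; rewrite W1 Wm /= => lt_from3.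
have [/allP W_all|/allPn[i]] := boolP (all W (iota 3 (m - 4))); last first.
  by rewrite mem_iota => i_in Wi; exists i => //; move: i_in; rewrite /within; lia.
suff : m.-2.+1 - 3 <= (nspread W 3 m.-2).*2 by lia.
by apply: nspread_full => i; rewrite /within => i_in; apply: W_all; rewrite mem_iota; lia.
Qed.

Lemma nonface_colon (W : pred nat) : W 1 -> W m.-1 -> W m ->
  a.-1 <= nspread W 2 m.-2 -> a.-2 <= nspread W 3 (m - 3) -> ~~ face a m W.
Proof.
move=> W1 Wm1 Wm le_V le_K; apply/negP => faceW.
have [i i_in Wi] := face_1m_missing W1 Wm faceW.
have /andP[i_ge i_le] := i_in; have i_gt0 : 0 < i by lia.
have /andP[lt_from2] := faceW; rewrite W1 Wm /= => lt_from3.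
have at_m1 : nspread W m.-1 m.-1 = 1 by rewrite nspread_left // Wm1 nspread_gt.
have := nspread_gap W (p := 2) (i := m - 3) (j := m.-1) (q := m.-1).
have := nspread_gap W (p := 2) (i := i.-1) (j := i.+1) (q := m - 3).
have := nspread_gap W (p := 3) (i := i.-1) (j := i.+1) (q := m.-2).
have := nspread_splitN 2 m.-2 i_gt0 Wi; have := nspread_splitN 3 (m - 3) i_gt0 Wi.
lia.
Qed.

Lemma face_extend_avoiding (W : pred nat) i : face a m W -> 2 <= i <= m.-2 -> ~~ W i ->
  exists t, [/\ i \notin t, spread_seq a.-1 2 m.-2 t \/ spread_seq a.-2 3 (m - 3) t
              & face a m (adjoin W t)].
Proof.
move=> faceW i_in Wi; have /andP[lt_from2 _] := faceW.
have [/nspread_geP[t t_spread Wt]|lt_from3] := leqP a.-1 (nspread W 3 m.-2).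
  exists t; split; first by apply: contra Wi => /(allP Wt).
    by left; apply: spread_seq_widen t_spread _ _; lia.
  by apply: face_sub faceW => [|j _ /orP[|/(allP Wt)]] //; lia.
pose l2 := nspread W 2 i.-1; pose l3 := nspread W 3 i.-1.
pose r2 := nspread W i.+1 m.-2; pose r1 := nspread W i.+1 m.-1.
have /orP[/and3P[le_a fit_l fit_r]|/and3P[le_a fit_l fit_r]] :
  [&& l2 + r2 <= a.-2, l2.*2 + 2 <= i & r2.*2 + i <= m.-2] ||
  [&& l3 + r1 <= a.-2, l3.*2 + 3 <= i & r1.*2 + i <= m.-1].
- have : l2 + r1 <= nspread W 2 m.-1 by apply: nspread_gap; lia.
  have : l3 + r2 <= nspread W 3 m.-2 by apply: nspread_gap; lia.
  have : l3 <= l2 <= l3.+1 by rewrite nspread_leftS leq_nspread_wide.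
  have : r2 <= r1 <= r2.+1 by rewrite nspread_rightS leq_nspread_wide //; lia.
  have := nspread_double_leq W 2 i.-1; have := nspread_double_leq W 3 i.-1.
  have := nspread_double_leq W i.+1 m.-2; have := nspread_double_leq W i.+1 m.-1.
  rewrite -/l2 -/l3 -/r2 -/r1; lia.
- have [|t [it t_spread le_t]] := @nspread_extend_around W 2 i m.-2 a.-2 isT Wi le_a fit_l fit_r.
    lia.
  exists t; split=> //; first by right; apply: spread_seq_widen t_spread _ _; lia.
  apply: face_small; first by apply: leq_ltn_trans (nspread_rightS _ _ _) _; lia.
  apply: (@leq_ltn_trans a.-2); last lia.
  by apply: leq_trans le_t; apply: leq_nspread_wide.
- have [|t [it t_spread le_t]] := @nspread_extend_around W 3 i m.-1 a.-2 isT Wi le_a fit_l fit_r.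
    lia.
  have {}le_t := nspread_adjoin_cons2 le_t.
  exists (2 :: t); split; first by rewrite inE negb_or it; lia.
    left; have -> : a.-1 = a.-2.+1 by lia.
    by rewrite spread_seq_cons /within (spread_seq_widen t_spread) //; lia.
  apply: face_small; first by apply: leq_ltn_trans (nspread_leftS _ _ _) _; lia.
  apply: (@leq_ltn_trans a.-2); last lia.
  by apply: leq_trans le_t; apply: leq_nspread_wide; lia.
Qed.

Lemma face_extend (W : pred nat) : face a m W -> ~~ [&& W 1, W m.-1 & W m] ->
  exists2 t, spread_seq a.-1 2 m.-2 t & face a m (adjoin W t).
Proof.
move=> faceW not_y; have /andP[lt_from2 lt_from3] := faceW.
have [W1m|W1m] := boolP (W 1 && W m); last first.
  have [||t t_spread le_t] := @nspread_extend W false a.-1 2 m.-1; [lia|lia|].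
  have {}t_spread : spread_seq a.-1 2 m.-2 t by apply: spread_seq_widen t_spread _ _; lia.
  exists t => //; apply/andP; split; first by apply: leq_ltn_trans le_t _; lia.
  by rewrite !(adjoin_out _ t_spread) ?(negPf W1m) // /within; lia.
rewrite W1m /= in lt_from3.
have [||t t_spread le_t] := @nspread_extend W true a.-2 3 m.-2; [lia|lia|].
have {}t_spread : spread_seq a.-1 2 m.-2 (2 :: t).
  have -> : a.-1 = a.-2.+1 by lia.
  by rewrite spread_seq_cons /within (spread_seq_widen t_spread) //; lia.
have {}le_t := nspread_adjoin_cons2 le_t.
exists (2 :: t) => //; apply: face_small; last by apply: leq_ltn_trans le_t _; lia.
have m1_gt0 : 0 < m.-1 by lia.
have {not_y}Wm1 : ~~ adjoin W (2 :: t) m.-1.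
  rewrite (adjoin_out _ t_spread); last by rewrite /within; lia.
  by case/andP: W1m not_y => -> ->; rewrite andbT.
apply: leq_ltn_trans (nspread_leftS _ _ _) _.
apply: leq_ltn_trans (_ : _ <= (nspread (adjoin W (2 :: t)) 3 m.-2).+1) _; last lia.
rewrite ltnS; apply: leq_trans (nspread_splitN _ _ m1_gt0 Wm1) _.
by rewrite [X in _ + X]nspread_gt ?addn0 //; lia.
Qed.

End Faces.

Lemma rcons_common_suffix (t t' : seq nat) : size t = size t' -> t != t' ->
  exists s s' x x' q, [/\ t = rcons s x ++ q, t' = rcons s' x' ++ q,
                          size s = size s' & x != x'].
Proof.
elim/last_ind: t t' => [|t z IHt] t'; case/lastP: t' => [|t' z'] //;
  rewrite ?size_rcons // => /succn_inj eq_sz neq.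
have [eq_z|neq_z] := eqVneq z z'; last by exists t, t', z, z', [::]; rewrite !cats0.
have neq_t : t != t' by apply: contraNneq neq => ->; rewrite eq_z.
have [s [s' [x [x' [q [-> -> eq_s neq_x]]]]]] := IHt _ eq_sz neq_t.
by exists s, s', x, x', (rcons q z); rewrite -!rcons_cat eq_z.
Qed.

Lemma tight_suffix s x : pairwise spread (rcons s x) -> exists s0 x0 r,
  [/\ rcons s x = s0 ++ x0 :: r, x = x0 + (size r).*2, all (fun y => y.+2 < x0) s0
    & all (leq^~ x) r].
Proof.
elim/last_ind: s x => [|s z IHs] x; first by exists [::], x, [::]; rewrite addn0.
rewrite pairwise_rcons all_rcons => /andP[/andP[zx _] sp_z].
move: zx; rewrite /spread leq_eqVlt => /predU1P[<-|lt_zx].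
  have [s0 [x0 [r [-> def_z lt_x0 r_le]]]] := IHs z sp_z.
  exists s0, x0, (rcons r z.+2); rewrite rcons_cat size_rcons doubleS !addnS -def_z; split=> //.
  by rewrite all_rcons leqnn; apply: sub_all r_le => y /= /leqW/leqW.
exists (rcons s z), x, [::]; split; rewrite ?cats1 ?addn0 //= all_rcons lt_zx /=.
move: sp_z; rewrite pairwise_rcons => /andP[+ _].
by apply: sub_all => y; rewrite /spread; lia.
Qed.

(* When [p] exceeds [lo], it is [lo.+1]: the sequences of size [n] considered
   below may then have one element left of [p]. *)
Definition nspread_bounded (n lo : nat) (ivs : seq (nat * nat)) (W : pred nat) : bool :=
  all (fun iv => nspread W iv.1 iv.2 <= n - (lo < iv.1)) ivs.

Lemma nspread_bounded_sub n lo ivs (W W' : pred nat) : {subset W <= W'} ->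
  nspread_bounded n lo ivs W' -> nspread_bounded n lo ivs W.
Proof.
move=> sub; apply: sub_all => iv; apply: leq_trans.
by apply: leq_nspread => i -> /sub.
Qed.

Section Lowering.
Variables (n lo hi : nat) (s q s0 r : seq nat) (x x0 : nat).
Let x' := x0 + (size r).*2.
Let t := rcons s x ++ q.
Let t' := s0 ++ x0 :: (r ++ q).
Hypotheses (t_spread : spread_seq n lo hi t) (t'_spread : spread_seq n lo hi t').
Hypotheses (lo_gt0 : 0 < lo) (sz_s : size s = size s0 + size r).
Hypothesis lt_x : x < x'.

Let x_in : within lo hi x.
Proof. by apply: spread_seq_within t_spread _; rewrite mem_cat mem_rcons mem_head. Qed.

Let x0_in : within lo hi x0.
Proof. by apply: spread_seq_within t'_spread _; rewrite mem_cat mem_head orbT. Qed.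

Let sz_q : (size s).+1 + size q = n.
Proof. by rewrite -(size_spread_seq t_spread) size_cat size_rcons. Qed.

Let prefix_spread : spread_seq (size s).+1 lo x (rcons s x).
Proof.
move: t_spread; rewrite spread_seq_cat size_rcons => /and4P[_ + _ _].
by rewrite !spread_seq_rcons // => /andP[/andP[lo_x _] ->]; rewrite /within lo_x leqnn.
Qed.

Let suffix_spread : spread_seq (size r + size q).+1 x0 hi (x0 :: r ++ q).
Proof.
move: t'_spread; rewrite spread_seq_cat /= size_cat => /and4P[_ _ + _].
by rewrite !spread_seq_cons => /andP[/andP[_ x0_hi] ->]; rewrite /within leqnn x0_hi.
Qed.

Lemma lower_gt : lo < x0.
Proof. by have := spread_seq_double_leq prefix_spread; move: lt_x; rewrite /x'; lia. Qed.

Hypothesis lt_x0 : all (fun y => y.+2 < x0) s0.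

Lemma lower_spread : spread_seq n lo hi (s0 ++ x0.-1 :: (r ++ q)).
Proof.
have := lower_gt; have := x0_in; rewrite /within => x0_le lo_x0.
move: suffix_spread t'_spread; rewrite !spread_seq_cat /= size_cat !spread_seq_cons.
case/andP => _ rq_spread /and4P[-> -> _ /allrelP s0_lt] /=; apply/andP; split.
  apply/andP; split; first by rewrite /within; lia.
  by apply: spread_seq_widen rq_spread _ _; lia.
apply/allrelP => y z y_s0; rewrite inE => /predU1P[->|z_rq].
  by have := allP lt_x0 y y_s0; rewrite /spread; lia.
by apply: s0_lt; rewrite ?inE ?z_rq ?orbT.
Qed.

Hypothesis r_le : all (leq^~ x') r.

(* A spread sequence through [x0.-1] has at most [size s0] smaller elements, by
   the bound for [t'], and at most [n - size s - 1] elements beyond [x'], by the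
   bound for [t]. *)
Lemma lower_bounded (sigma : pred nat) p p' : p <= lo.+1 -> hi <= p' ->
  nspread (adjoin sigma t) p p' <= n - (lo < p) ->
  nspread (adjoin sigma t') p p' <= n - (lo < p) ->
  nspread (predU1 x0.-1 (adjoin sigma t')) p p' <= n - (lo < p).
Proof.
set W := adjoin sigma t; set W' := adjoin sigma t' => le_p le_p' le_t le_t'.
have lo_x0 := lower_gt; have /andP[_ x0_hi] := x0_in; have /andP[lo_x x_hi] := x_in.
apply: leq_trans (nspread_predU1 _ _ _ _) _; rewrite geq_max le_t' /=.
have before_x0 : nspread W' p (x0.-1 - 2) + (size r + size q).+1 <= n - (lo < p).
  apply: leq_trans le_t'.
  apply: leq_trans (_ : _ <= nspread W' p (x0.-1 - 2) + nspread W' x0 p') _; last first.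
    by apply: nspread_gap; lia.
  rewrite leq_add2l; apply/nspread_geP; exists (x0 :: r ++ q).
    by apply: spread_seq_widen suffix_spread _ _.
  by apply/allP => y y_suf; rewrite /W' /adjoin /= mem_cat y_suf !orbT.
have up_to_x' : nspread W' x0.-1.+2 x' <= size r.
  by have := nspread_double_leq W' x0.-1.+2 x'; rewrite /x'; lia.
have head_le y : y \in s0 ++ x0 :: r -> y <= x'.
  by rewrite mem_cat inE /x' => /or3P[/(allP lt_x0)|/eqP ->|/(allP r_le)]; clear; lia.
have after_x' : nspread W' x'.+1 p' <= nspread W x'.+1 p'.
  apply: leq_nspread => y y_in; rewrite y_in /W /W' /adjoin /= => /orP[->//|].
  rewrite /t /t' -cat_cons catA !mem_cat => /orP[|->]; last by rewrite !orbT.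
  by rewrite -mem_cat => /head_le; case/andP: y_in => + _; rewrite ltnNge => /negPf ->.
have up_to_x : (size s).+1 <= nspread W p x + (lo < p).
  apply: (@leq_trans (nspread W lo x)).
    apply/nspread_geP; exists (rcons s x) => //.
    by apply/allP => y y_pre; rewrite /W /adjoin /= mem_cat y_pre orbT.
  case: ltnP => [lt_p|ge_p]; last by rewrite addn0 leq_nspread_wide.
  have -> : p = lo.+1 by lia.
  by rewrite addn1 nspread_leftS.
have beyond_x : nspread W p x + nspread W x'.+1 p' <= n - (lo < p).
  by apply: leq_trans le_t; apply: nspread_gap; rewrite /x'; lia.
have := nspread_split W' x0.-1.+2 x' p'; lia.
Qed.

End Lowering.

Lemma lower_spread_seq n lo hi ivs (sigma : pred nat) s s' x x' q : 0 < lo ->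
  all (fun iv => (iv.1 <= lo.+1) && (hi <= iv.2)) ivs ->
  spread_seq n lo hi (rcons s x ++ q) -> spread_seq n lo hi (rcons s' x' ++ q) ->
  nspread_bounded n lo ivs (adjoin sigma (rcons s x ++ q)) ->
  nspread_bounded n lo ivs (adjoin sigma (rcons s' x' ++ q)) ->
  size s = size s' -> x < x' ->
  exists u, [/\ spread_seq n lo hi u, sumn u < sumn (rcons s' x' ++ q)
              & nspread_bounded n lo ivs (adjoin (adjoin sigma u) (rcons s' x' ++ q))].
Proof.
move=> lo_gt0 /allP ivs_wide t_spread t'_spread t_bounded t'_bounded eq_sz lt_x.
have [s0 [x0 [r [def_s' def_x' lt_x0 r_le]]]] : exists s0 x0 r,
  [/\ rcons s' x' = s0 ++ x0 :: r, x' = x0 + (size r).*2, all (fun y => y.+2 < x0) s0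
    & all (leq^~ x') r].
  by apply: tight_suffix; move: t'_spread; rewrite spread_seq_cat => /and4P[_ /and3P[]].
have sz_s : size s = size s0 + size r.
  by have := congr1 size def_s'; rewrite size_rcons size_cat /= addnS eq_sz => -[].
rewrite {}def_s' -catA cat_cons in t'_spread t'_bounded *.
rewrite {}def_x' in lt_x r_le.
have lo_x0 := lower_gt t_spread t'_spread lo_gt0 sz_s lt_x.
exists (s0 ++ x0.-1 :: (r ++ q)); split.
- exact: lower_spread t_spread t'_spread lo_gt0 sz_s lt_x lt_x0.
- by rewrite !sumn_cat /= ltn_add2l ltn_add2r ltn_predL (leq_ltn_trans _ lo_x0).
apply/allP => iv iv_in; have /andP[le_lo le_hi] := ivs_wide iv iv_in.
apply: leq_trans (lower_bounded t_spread t'_spread lo_gt0 sz_s lt_x lt_x0 r_le le_lo le_hi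
  (allP t_bounded iv iv_in) (allP t'_bounded iv iv_in)).
apply: leq_nspread => y ->; rewrite /adjoin /= !(mem_cat, inE).
by case: (sigma y); case: (y == x0.-1); case: (y \in s0); case: (y \in r);
   case: (y \in q); rewrite ?orbT.
Qed.

Definition chain_connected (ok : pred (pred nat)) (n lo hi : nat) (sigma : pred nat) : Prop :=
  forall (X : Type) (lam : seq nat -> X),
    (forall t t', spread_seq n lo hi t -> spread_seq n lo hi t' ->
       ok (adjoin (adjoin sigma t) t') -> lam t = lam t') ->
  forall t t', spread_seq n lo hi t -> spread_seq n lo hi t' ->
    ok (adjoin sigma t) -> ok (adjoin sigma t') -> lam t = lam t'.

Lemma nspread_bounded_connected n lo hi ivs (sigma : pred nat) : 0 < lo ->
  all (fun iv => (iv.1 <= lo.+1) && (hi <= iv.2)) ivs ->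
  chain_connected (nspread_bounded n lo ivs) n lo hi sigma.
Proof.
move=> lo_gt0 ivs_wide X lam lam_eq t t'.
have [k] := ubnP (sumn t + sumn t').
elim: k t t' => // k IHk t t' lt_k t_spread t'_spread t_bounded t'_bounded.
have [->//|neq_t] := eqVneq t t'.
have eq_sz : size t = size t' by rewrite (size_spread_seq t_spread) (size_spread_seq t'_spread).
have [s [s' [x [x' [q [def_t def_t' eq_s neq_x]]]]]] := rcons_common_suffix eq_sz neq_t.
have bounded_u u v : nspread_bounded n lo ivs (adjoin (adjoin sigma u) v) ->
    nspread_bounded n lo ivs (adjoin sigma u).
  by apply: nspread_bounded_sub => i sigma_u; apply/orP; left.
subst t t'; wlog lt_x : s s' x x' eq_s neq_x lt_k t_spread t'_spread t_bounded t'_bounded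
    {neq_t eq_sz} / x < x'.
  move=> lowering; have /orP[lt_x|lt_x] : (x < x') || (x' < x) by rewrite -neq_ltn.
    exact: (lowering s s' x x').
  by apply/esym/(lowering s' s x' x); rewrite // 1?eq_sym // addnC.
have [u [u_spread lt_u u_bounded]] := lower_spread_seq lo_gt0 ivs_wide
  t_spread t'_spread t_bounded t'_bounded eq_s lt_x.
rewrite -(lam_eq _ _ u_spread t'_spread u_bounded).
apply: IHk => //; last exact: bounded_u u_bounded.
by rewrite ltnS in lt_k; apply: leq_trans lt_k; rewrite ltn_add2l.
Qed.

Lemma eq_chain_connected ok ok' n lo hi (sigma : pred nat) :
  (forall W : pred nat, (forall i, ~~ within lo hi i -> W i = sigma i) -> ok W = ok' W) ->
  chain_connected ok n lo hi sigma -> chain_connected ok' n lo hi sigma.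
Proof.
move=> eq_ok conn X lam lam_eq t t' t_spread t'_spread t_ok t'_ok.
have ok_out u : spread_seq n lo hi u -> ok (adjoin sigma u) = ok' (adjoin sigma u).
  by move=> u_spread; apply: eq_ok => i; apply: adjoin_out u_spread.
apply: conn => //; rewrite ?ok_out // => u v u_spread v_spread uv_ok.
apply: lam_eq => //; rewrite -eq_ok // => i i_out.
by rewrite (adjoin_out _ v_spread) // (adjoin_out _ u_spread).
Qed.

Section FaceConnected.
Variables (a m : nat).
Hypotheses (a_ge3 : 3 <= a) (m_gt : a.*2 < m).

Lemma face_connected_V (sigma : pred nat) :
  chain_connected (face a m) a.-1 2 m.-2 sigma.
Proof.
pose ivs := (2, m.-1) :: if sigma 1 && sigma m then [:: (3, m.-2)] else [::].
apply: (@eq_chain_connected (nspread_bounded a.-1 2 ivs)) => [W W_out|].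
  rewrite /nspread_bounded /face !W_out /ivs; try by rewrite /within; lia.
  by case: (_ && _) => /=; lia.
by apply: nspread_bounded_connected => //; rewrite /ivs; case: (_ && _) => /=; lia.
Qed.

Lemma face_connected_K (sigma : pred nat) : sigma 1 -> sigma m.-1 -> sigma m ->
  chain_connected (face a m) a.-2 3 (m - 3) sigma.
Proof.
move=> sig1 sigm1 sigm.
apply: (@eq_chain_connected (nspread_bounded a.-2 3 [:: (3, m.-2); (2, m - 3)])); last first.
  by apply: nspread_bounded_connected => //=; lia.
move=> W W_out; rewrite /nspread_bounded /face !W_out ?sig1 ?sigm /=; try by rewrite /within; lia.
suff -> : nspread W 2 m.-1 = (nspread W 2 (m - 3)).+1 by lia.
have at_m1 : nspread W m.-1 m.-1 = 1.
  by rewrite nspread_left // W_out ?sigm1 ?nspread_gt //; rewrite /within; lia.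
apply/eqP; rewrite eqn_leq; apply/andP; split.
  apply: leq_trans (nspread_split W 2 (m - 3) m.-1) _.
  by rewrite -[leqRHS]addn1 leq_add2l nspread_short //; lia.
by rewrite -addn1 -at_m1; apply: nspread_gap; lia.
Qed.

End FaceConnected.

(** * Monomial ideals *)

Local Open Scope ring_scope.

Section Ideals.
Variable T : comNzRingType.
Implicit Types (G : T -> Prop) (f g r : T).

Lemma in_ideal0 G : in_ideal G 0.
Proof. by exists [::]; rewrite big_nil. Qed.

Lemma in_ideal_gen G r g : G g -> in_ideal G (r * g).
Proof.
by move=> Gg; exists [:: (r, g)]; rewrite big_seq1; split=> // q; rewrite inE => /eqP ->.
Qed.

Lemma in_ideal1 G g : G g -> in_ideal G g.
Proof. by move=> Gg; rewrite -[g]mul1r; apply: in_ideal_gen. Qed.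

Lemma in_idealD G f g : in_ideal G f -> in_ideal G g -> in_ideal G (f + g).
Proof.
move=> [s [Gs ->]] [s' [Gs' ->]]; exists (s ++ s'); rewrite big_cat; split=> //.
by move=> q; rewrite mem_cat => /orP[/Gs|/Gs'].
Qed.

Lemma in_ideal_ind G (P : T -> Prop) :
  P 0 -> (forall f g, P f -> P g -> P (f + g)) ->
  (forall r g, G g -> P (r * g)) -> forall f, in_ideal G f -> P f.
Proof.
move=> P0 PD PG f [s [Gs ->]]; rewrite big_seq.
by apply: (big_ind P) => // q /Gs; apply: PG.
Qed.

Lemma in_idealM G r f : in_ideal G f -> in_ideal G (r * f).
Proof.
elim/in_ideal_ind: f / => [|f g Gf Gg|r' g Gg].
- by rewrite mulr0; apply: in_ideal0.
- by rewrite mulrDr; apply: in_idealD.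
- by rewrite mulrA; apply: in_ideal_gen.
Qed.

Lemma in_idealB G f g : in_ideal G f -> in_ideal G g -> in_ideal G (f - g).
Proof. by move=> Gf Gg; apply: in_idealD => //; rewrite -mulN1r; apply: in_idealM. Qed.

Lemma in_ideal_sum G (I : eqType) (s : seq I) (F : I -> T) :
  (forall i, i \in s -> in_ideal G (F i)) -> in_ideal G (\sum_(i <- s) F i).
Proof.
move=> GF; rewrite big_seq; apply: (big_ind (in_ideal G)) => //.
  exact: in_ideal0.
exact: in_idealD.
Qed.

End Ideals.

Lemma in_ideal_morph (T T' : comNzRingType) (h : {rmorphism T -> T'})
    (G : T -> Prop) (G' : T' -> Prop) :
  (forall g, G g -> in_ideal G' (h g)) -> forall f, in_ideal G f -> in_ideal G' (h f).
Proof.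
move=> sub f; elim/in_ideal_ind: f / => [|f g|r g /sub].
- by rewrite rmorph0; apply: in_ideal0.
- by rewrite rmorphD; apply: in_idealD.
- by rewrite rmorphM; apply: in_idealM.
Qed.

Lemma in_ideal_mull (T : comNzRingType) (c : T) (G G' : T -> Prop) :
  (forall g, G g -> in_ideal G' (c * g)) -> forall f, in_ideal G f -> in_ideal G' (c * f).
Proof.
move=> sub f; elim/in_ideal_ind: f / => [|f g|r g /sub].
- by rewrite mulr0; apply: in_ideal0.
- by rewrite mulrDr; apply: in_idealD.
- by rewrite mulrCA; apply: in_idealM.
Qed.

Lemma in_ideal_sub (T : comNzRingType) (G G' : T -> Prop) : (forall g, G g -> in_ideal G' g) ->
  forall f, in_ideal G f -> in_ideal G' f.
Proof. exact: (in_ideal_morph (h := idfun)). Qed.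

Lemma eq_in_ideal (T : comNzRingType) (G G' : T -> Prop) : (forall g, G g <-> G' g) ->
  forall f, in_ideal G f <-> in_ideal G' f.
Proof. by move=> eqG f; split; apply: in_ideal_sub => g /eqG /in_ideal1. Qed.

Definition prod_gens {T : comNzRingType} (x : nat -> T) (D : seq nat -> Prop) (f : T) : Prop :=
  exists2 s, D s & f = \prod_(i <- s) x i.

Lemma prod_gensI (T : comNzRingType) (x : nat -> T) (D : seq nat -> Prop) s :
  D s -> prod_gens x D (\prod_(i <- s) x i).
Proof. by exists s. Qed.

Lemma IgenP (T : comNzRingType) (x : nat -> T) n p q f :
  Igen x n p q f <-> prod_gens x (spread_seq n p q) f.
Proof.
split=> [[t [sz_t sorted_t t_in ->]]|[t /and3P[/eqP sz_t sp_t t_in] ->]].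
  by exists t => //; rewrite /spread_seq sz_t eqxx -(sorted_pairwise spread_trans) sorted_t.
by exists t; split=> //; rewrite (sorted_pairwise spread_trans).
Qed.

Lemma IgensP (T : comNzRingType) (x : nat -> T) a m f :
  Igens x a m f <-> prod_gens x (min_nonface a m) f.
Proof.
split=> [[/IgenP[t t_spread ->]|[_ [/IgenP[t t_spread ->] ->]]]|[s [s_spread|[t t_spread ->]] ->]].
- by apply: prod_gensI; left.
- by exists ([:: 1; m]%N ++ t); [right; exists t|rewrite !big_cons mulrA].
- by left; apply/IgenP; exists s.
- right; exists (\prod_(i <- t) x i); rewrite !big_cons mulrA; split=> //.
  by apply/IgenP; exists t.
Qed.

Lemma in_IgenE (T : comNzRingType) (x : nat -> T) n p q f :
  in_ideal (Igen x n p q) f <-> in_ideal (prod_gens x (spread_seq n p q)) f.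
Proof. exact/eq_in_ideal/IgenP. Qed.

Lemma in_IgensE (T : comNzRingType) (x : nat -> T) a m f :
  in_ideal (Igens x a m) f <-> in_ideal (prod_gens x (min_nonface a m)) f.
Proof. exact/eq_in_ideal/IgensP. Qed.

Section Monomials.
Variables (k : fieldType) (n : nat).
Implicit Types (f g : {mpoly k[n]}) (mu d : 'X_{1..n}).

Lemma mcoeffXM d f mu : ('X_[d] * f)@_(d + mu) = f@_mu.
Proof. by rewrite mulrC mcoeffMX. Qed.

Lemma mcoeffXM_eq0 d f mu : ~~ (d <= mu)%MM -> ('X_[d] * f)@_mu = 0.
Proof.
move=> ndiv; apply: memN_msupp_eq0; apply: contra ndiv.
by rewrite mulrC (perm_mem (msuppMX _ _)) => /mapP[nu _ ->]; apply: lem_addr.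
Qed.

Lemma in_monomial_ideal (G : {mpoly k[n]} -> Prop) (D : 'X_{1..n} -> Prop) :
  (forall g, G g <-> exists2 d, D d & g = 'X_[d]) -> forall f,
  in_ideal G f <-> (forall mu, mu \in msupp f -> exists2 d, D d & (d <= mu)%MM).
Proof.
move=> GD f; split.
  elim/in_ideal_ind: f / => [mu|f g IHf IHg mu|r g /GD[d Dd ->] mu].
  - by rewrite msupp0.
  - by move/msuppD_le; rewrite mem_cat => /orP[/IHf|/IHg].
  - by rewrite (perm_mem (msuppMX _ _)) => /mapP[nu _ ->]; exists d => //; apply: lem_addr.
move=> Df; rewrite (mpolyE f); apply: in_ideal_sum => mu /Df[d Dd le_d].
rewrite -(submK le_d) mpolyXD scalerAl; apply: in_ideal_gen.
by apply/GD; exists d.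
Qed.

Lemma mpoly_of_coef (b : 'X_{1..n} -> k) (B : nat) :
  exists f, forall mu, f@_mu = if (mdeg mu < B)%N then b mu else 0.
Proof.
exists (\sum_(c : 'X_{1..n < B}) b c *: 'X_[c]) => mu.
case: ltnP => [lt_B|le_B]; first by rewrite mcoeff_mpoly.
rewrite raddf_sum /= big1 // => c _; rewrite mcoeffZ mcoeffX.
by case: eqP => [eq_c|]; rewrite ?mulr0 //; have := bmdeg c; rewrite ltnNge eq_c le_B.
Qed.

End Monomials.

Section SquarefreeIdeals.
Variables (k : fieldType) (N : nat).
Local Notation ix i := (inord i.-1 : 'I_N.+1).

Definition xvar (i : nat) : {mpoly k[N.+1]} := 'X_(ix i).

Definition mnm_seq (t : seq nat) : 'X_{1..N.+1} := (\sum_(i <- t) U_(ix i))%MM.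

(* Variables are numbered from 1. *)
Definition mnm_supp (mu : 'X_{1..N.+1}) : pred nat := fun i => (0 < mu (ix i))%N.

Lemma prod_xvar t : \prod_(i <- t) xvar i = 'X_[mnm_seq t].
Proof. by rewrite /mnm_seq mprodXE. Qed.

Lemma mnm_seq_cat s t : mnm_seq (s ++ t) = (mnm_seq s + mnm_seq t)%MM.
Proof. by rewrite /mnm_seq big_cat. Qed.

Lemma mnm_seqE t j : mnm_seq t j = count_mem j [seq ix i | i <- t].
Proof.
rewrite /mnm_seq mnm_sumE -sum1_count big_map [RHS]big_mkcond.
by apply: eq_bigr => i _; rewrite mnm1E /=; case: (_ == _).
Qed.

Lemma ix_inj : {in within 1 N.+1 &, injective (fun i => ix i)}.
Proof.
move=> i j; rewrite !unfold_in /= => i_in j_in /(congr1 val).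
by rewrite /= !inordK; lia.
Qed.

Lemma mnm_suppD mu nu i : mnm_supp (mu + nu) i = mnm_supp mu i || mnm_supp nu i.
Proof. by rewrite /mnm_supp mnmDE addn_gt0. Qed.

Lemma mnm_supp_seq t i : all (within 1 N.+1) t -> within 1 N.+1 i ->
  mnm_supp (mnm_seq t) i = (i \in t).
Proof.
move=> /allP t_in i_in; rewrite /mnm_supp mnm_seqE -has_count has_pred1.
apply/mapP/idP => [[j jt eq_ij]|it]; last by exists i.
by rewrite (ix_inj i_in (t_in j jt) eq_ij).
Qed.

Lemma mnm_seq_le t (mu : 'X_{1..N.+1}) : uniq t -> all (within 1 N.+1) t ->
  (mnm_seq t <= mu)%MM = all (mnm_supp mu) t.
Proof.
move=> uniq_t /allP t_in; apply/mnm_lepP/allP => [le_mu i it|mu_t j].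
  apply: leq_trans (le_mu (ix i)); rewrite mnm_seqE -has_count has_pred1.
  by apply/mapP; exists i.
rewrite mnm_seqE count_uniq_mem.
  by case: mapP => // -[i it ->]; apply: mu_t.
by rewrite map_inj_in_uniq // => i i' /t_in i_in /t_in i'_in; apply: ix_inj.
Qed.

Definition sqfree_family (D : seq nat -> Prop) : Prop :=
  forall s, D s -> uniq s /\ all (within 1 N.+1) s.

Lemma in_sqfree_ideal (D : seq nat -> Prop) (f : {mpoly k[N.+1]}) : sqfree_family D ->
  in_ideal (prod_gens xvar D) f <->
  (forall mu, mu \in msupp f -> exists2 s, D s & all (mnm_supp mu) s).
Proof.
move=> D_sqfree; rewrite (@in_monomial_ideal k _ _ (fun d => exists2 s, D s & d = mnm_seq s)).
  split=> f_div mu /f_div => [[_ [s Ds ->]]|[s Ds]].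
    by have [uniq_s s_in] := D_sqfree s Ds; rewrite mnm_seq_le //; exists s.
  have [uniq_s s_in] := D_sqfree s Ds; rewrite -mnm_seq_le // => s_le.
  by exists (mnm_seq s) => //; exists s.
move=> g; split=> [[s Ds ->]|[_ [s Ds ->] ->]].
  by rewrite prod_xvar; exists (mnm_seq s) => //; exists s.
by exists s; rewrite // prod_xvar.
Qed.

Lemma sqfree_ideal_regular (D : seq nat -> Prop) z (f : {mpoly k[N.+1]}) :
  sqfree_family D -> within 1 N.+1 z -> (forall s, D s -> z \notin s) ->
  in_ideal (prod_gens xvar D) (xvar z * f) -> in_ideal (prod_gens xvar D) f.
Proof.
move=> D_sqfree z_in z_out /(in_sqfree_ideal _ D_sqfree) zf_div.
apply/(in_sqfree_ideal _ D_sqfree) => mu f_mu.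
have [|s Ds /allP s_supp] := zf_div (U_(ix z) + mu)%MM.
  by rewrite mcoeff_msupp mcoeffXM -mcoeff_msupp.
exists s => //; apply/allP => i i_s; have := s_supp i i_s; rewrite mnm_suppD.
have [_ /allP s_in] := D_sqfree s Ds.
suff /negPf -> : ~~ mnm_supp U_(ix z) i by [].
rewrite /mnm_supp mnm1E lt0b; apply: contra (z_out s Ds) => /eqP eq_z.
by rewrite (ix_inj z_in (s_in i i_s) eq_z).
Qed.

Lemma spread_seq_sqfree n p q : (0 < p)%N -> (q <= N.+1)%N -> sqfree_family (spread_seq n p q).
Proof.
move=> p_gt0 q_le t t_spread; split; first exact: spread_seq_uniq t_spread.
exact: spread_seq_all_within t_spread p_gt0 q_le.
Qed.

Lemma in_Igen n p q (f : {mpoly k[N.+1]}) : (0 < p)%N -> (q <= N.+1)%N ->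
  in_ideal (Igen xvar n p q) f <->
  (forall mu, mu \in msupp f -> (n <= nspread (mnm_supp mu) p q)%N).
Proof.
move=> p_gt0 q_le; rewrite in_IgenE (in_sqfree_ideal _ (spread_seq_sqfree p_gt0 q_le)).
by split=> f_div mu /f_div => [[t]|/nspread_geP[t]] t_spread supp_t;
   [apply/nspread_geP|]; exists t.
Qed.

Lemma min_nonface_sqfree a m : (1 < m)%N -> (m <= N.+1)%N -> sqfree_family (min_nonface a m).
Proof.
move=> m_gt1 m_le s s_nonface; split; first exact: min_nonface_uniq s_nonface.
apply: sub_all (min_nonface_within m_gt1 s_nonface) => i.
by rewrite /within; lia.
Qed.

Lemma in_face_ideal a m (f : {mpoly k[N.+1]}) : (1 < m)%N -> (m <= N.+1)%N ->
  in_ideal (Igens xvar a m) f <-> (forall mu, face a m (mnm_supp mu) -> f@_mu = 0).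
Proof.
move=> m_gt1 m_le; rewrite in_IgensE (in_sqfree_ideal _ (min_nonface_sqfree m_gt1 m_le)).
split=> [f_div mu face_mu|f_face mu f_mu].
  by apply: memN_msupp_eq0; apply: contraL face_mu => /f_div /nonfaceP.
by apply/nonfaceP; apply: contraL f_mu => /f_face; rewrite -mcoeff_eq0 => /eqP.
Qed.

End SquarefreeIdeals.

(** * Homomorphisms from J to R/I *)

Lemma spread_seq_bounded n lo hi (F : seq nat -> nat) :
  exists B, forall t, spread_seq n lo hi t -> (F t <= B)%N.
Proof.
exists (\max_(t : n.-tuple 'I_hi.+1) F (map val t))%N => t t_spread.
have sz_t : size [seq (inord i : 'I_hi.+1) | i <- t] == n.
  by rewrite size_map (size_spread_seq t_spread).
have -> : t = map val (Tuple sz_t).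
  rewrite /= -map_comp map_id_in // => i /(spread_seq_within t_spread) i_in /=.
  by rewrite inordK; lia.
exact: leq_bigmax.
Qed.

Section FaceIdealCoefficients.
Variables (k : fieldType) (a m N : nat).
Hypotheses (m_gt1 : (1 < m)%N) (m_le : (m <= N.+1)%N).
Local Notation R := {mpoly k[N.+1]}.
Local Notation mon s := ('X_[mnm_seq N s] : R).
Local Notation I := (in_ideal (Igens (xvar k N) a m)).
Local Notation standard mu := (face a m (mnm_supp mu)).

Lemma face_mnm_seqD s t (mu : 'X_{1..N.+1}) : all (within 1 N.+1) s ->
  (forall i, within 1 m i -> (i \in s) = (i \in t)) ->
  standard (mnm_seq N s + mu) = face a m (adjoin (mnm_supp mu) t).
Proof.
move=> s_in eq_st; apply: eq_face => [|i i_in]; first lia.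
rewrite mnm_suppD mnm_supp_seq ?eq_st // /adjoin /= 1?orbC //.
by move: i_in; rewrite /within; lia.
Qed.

Lemma colon_support s s' (f f' : R) mu i : I (mon s' * f - mon s * f') ->
  all (within 1 N.+1) s' -> within 1 N.+1 i ->
  standard (mnm_seq N s' + mu) -> f@_mu != 0 -> i \in s ->
  (i \in s') || mnm_supp mu i.
Proof.
move=> /(in_face_ideal _ _ m_gt1 m_le) I_colon s'_in i_in face_mu f_mu i_s.
have [le_s|ndiv] := boolP (mnm_seq N s <= mnm_seq N s' + mu)%MM; last first.
  have /eqP := I_colon _ face_mu.
  by rewrite mcoeffB mcoeffXM mcoeffXM_eq0 // subr0 (negPf f_mu).
rewrite -(mnm_supp_seq s'_in i_in) -mnm_suppD; apply: leq_trans (mnm_lepP le_s _).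
by rewrite mnm_seqE -has_count has_pred1; apply/mapP; exists i.
Qed.

Section Gluing.
Variables (n lo hi : nat) (ys zs : seq nat) (u : seq nat -> R).
Hypotheses (lo_gt0 : (0 < lo)%N) (hi_le : (hi <= m)%N).
Hypothesis zs_high : all (within m.+1 N.+1) zs.

Let zs_in : all (within 1 N.+1) zs.
Proof. by apply: sub_all zs_high => i; rewrite /within; lia. Qed.

Let zs_out i : within 1 m i -> (i \in zs) = false.
Proof.
by move=> i_in; apply/negP => /(allP zs_high); move: i_in; rewrite /within; lia.
Qed.

Let spread_in t : spread_seq n lo hi t -> all (within 1 N.+1) t.
Proof. by move/spread_seq_all_within; apply=> //; apply: leq_trans m_le. Qed.

Let face_t t mu : spread_seq n lo hi t ->
  standard (mnm_seq N t + mu) = face a m (adjoin (mnm_supp mu) t).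
Proof. by move=> /spread_in t_in; apply: face_mnm_seqD. Qed.

Let face_zs s t mu : spread_seq n lo hi s -> spread_seq n lo hi t ->
  face a m (adjoin (adjoin (mnm_supp mu) s) t) ->
  standard (mnm_seq N (zs ++ s ++ t) + mu).
Proof.
move=> /spread_in s_in /spread_in t_in face_st.
rewrite (face_mnm_seqD _ (t := s ++ t)).
- by rewrite face_adjoin_cat.
- by rewrite !all_cat zs_in s_in.
- by move=> i i_in; rewrite mem_cat zs_out.
Qed.

Hypothesis u_supp : forall t mu, spread_seq n lo hi t -> standard mu ->
  (u t)@_mu != 0 -> (mnm_seq N (ys ++ t) <= mu)%MM.
Hypothesis u_colon : forall t t', spread_seq n lo hi t -> spread_seq n lo hi t' ->
  I (mon (zs ++ t') * u t - mon (zs ++ t) * u t').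
Hypothesis connected : forall c : 'X_{1..N.+1},
  chain_connected (face a m) n lo hi (mnm_supp (c + mnm_seq N ys)).

Lemma glue_cofactor (c : 'X_{1..N.+1}) : exists b, forall t, spread_seq n lo hi t ->
  standard (mnm_seq N t + (c + mnm_seq N ys)) ->
  (u t)@_(mnm_seq N t + (c + mnm_seq N ys)) = b.
Proof.
have := @connected c; move: (c + mnm_seq N ys)%MM => e connected_e.
have [[t0 [t0_spread face_t0]]|none] := pselect (exists t, spread_seq n lo hi t /\
  standard (mnm_seq N t + e)); last first.
  by exists 0 => t t_spread face_te; case: none; exists t.
exists (u t0)@_(mnm_seq N t0 + e) => t t_spread face_te.
apply: (connected_e _ (fun t => (u t)@_(mnm_seq N t + e))) => //; rewrite -?face_t //.
move=> s s' s_spread s'_spread /(face_zs s_spread s'_spread) face_ss'.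
have assoc r r' : (mnm_seq N (zs ++ r) + (mnm_seq N r' + e))%MM =
                  (mnm_seq N (zs ++ r ++ r') + e)%MM.
  by rewrite !mnm_seq_cat !addmA.
have swap : (mnm_seq N (zs ++ s' ++ s) + e = mnm_seq N (zs ++ s ++ s') + e)%MM.
  by rewrite !mnm_seq_cat [X in (_ + X + _)%MM]addmC.
have /(in_face_ideal _ _ m_gt1 m_le)/(_ _ face_ss')/eqP := u_colon s_spread s'_spread.
by rewrite mcoeffB -{1}swap -!assoc !mcoeffXM subr_eq0 => /eqP.
Qed.

(* The cofactor of [mon (ys ++ t)] in [u t] does not depend on [t]: its
   coefficients are constant along chains. *)
Lemma glue_multiples : exists beta : R, forall t, spread_seq n lo hi t ->
  I (u t - beta * mon (ys ++ t)).
Proof.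
have [b b_coef] := choice glue_cofactor.
have [B u_deg] := spread_seq_bounded n lo hi (fun t => msize (u t)).
have [beta beta_coef] := mpoly_of_coef b B.
exists beta => t t_spread; apply/in_face_ideal => // mu face_mu; rewrite mcoeffB.
have [le_mu|ndiv] := boolP (mnm_seq N (ys ++ t) <= mu)%MM; last first.
  rewrite [beta * _]mulrC mcoeffXM_eq0 // subr0.
  by apply/eqP; apply: contraNT ndiv; apply: u_supp.
set c := (mu - mnm_seq N (ys ++ t))%MM.
have def_mu : mu = (mnm_seq N (ys ++ t) + c)%MM by rewrite addmC submK.
rewrite {2}def_mu mcoeffMX beta_coef; apply/eqP; rewrite subr_eq0; apply/eqP.
case: ltnP => [lt_c|le_c]; last first.
  apply/memN_msupp_eq0/msize_mdeg_ge/(leq_trans (u_deg t t_spread))/(leq_trans le_c).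
  by rewrite def_mu mdegD leq_addl.
have {}def_mu : mu = (mnm_seq N t + (c + mnm_seq N ys))%MM.
  by rewrite def_mu mnm_seq_cat addmC addmA [(c + _ + _)%MM]addmC.
by rewrite {1}def_mu b_coef // -def_mu.
Qed.

End Gluing.
End FaceIdealCoefficients.

Section Hom.
Variables (k : fieldType) (a m : nat).
Hypotheses (a_ge3 : (3 <= a)%N) (m_gt : (a.*2 < m)%N).
Local Notation R := {mpoly k[m.+2]}.
Local Notation mon s := ('X_[mnm_seq m.+1 s] : R).
Local Notation ys := [:: 1; m.-1; m]%N.
Local Notation zs := [:: m.+1; m.+2].
Local Notation I := (in_ideal (Igens (xR k m) a m)).
Local Notation V := (in_ideal (Igen (xR k m) a.-1 2 m.-2)).
Local Notation K := (in_ideal (Igen (xR k m) a.-2 3 (m - 3))).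
Local Notation J := (in_ideal (Jgens (xR k m) (z1R k m) (z2R k m) a m)).
Local Notation standard mu := (face a m (mnm_supp mu)).
Local Notation phi := (phi_rel (xR k m) (z1R k m) (z2R k m) a m).

Let m_gt1 : (1 < m)%N. Proof. by lia. Qed.
Let m_le : (m <= m.+2)%N. Proof. by lia. Qed.

Let ys_in : all (within 1 m.+2) ys.
Proof. by rewrite /= /within; lia. Qed.

Let prod_ys : xR k m 1 * xR k m m.-1 * xR k m m = mon ys.
Proof. by rewrite -prod_xvar !big_cons big_nil mulr1 mulrA. Qed.

Let prod_zs : z1R k m * z2R k m = mon zs.
Proof. by rewrite -prod_xvar !big_cons big_nil mulr1. Qed.

Lemma phi_relP u p : phi u p <-> exists v w i,
  [/\ V v, K w, I i, u = v + mon zs * w + i & p = mon ys * w].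
Proof.
split=> [[rs [ss [i [rs_gen ss_gen Ii -> ->]]]]|].
  exists (\sum_(q <- rs) q.1 * q.2), (\sum_(q <- ss) q.1 * q.2), i.
  rewrite -prod_ys -prod_zs !mulr_sumr; split=> //; [by exists rs|by exists ss| |].
    by congr (_ + _ + _); apply: eq_bigr => q _; rewrite mulrCA.
  by apply: eq_bigr => q _; rewrite mulrCA.
case=> v [w [i [[rs [rs_gen ->]] [ss [ss_gen ->]] Ii -> ->]]].
exists rs, ss, i; rewrite -prod_ys -prod_zs !mulr_sumr; split=> //.
  by congr (_ + _ + _); apply: eq_bigr => q _; rewrite mulrCA.
by apply: eq_bigr => q _; rewrite mulrCA.
Qed.

Lemma face_ideal_sub_V f : I f -> V f.
Proof.
move=> /(in_face_ideal _ _ m_gt1 m_le) f_face; apply/in_Igen => //; first lia.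
move=> mu f_mu; apply: (@nonface_nspread a m).
by apply: contraL f_mu => /f_face; rewrite -mcoeff_eq0 => /eqP.
Qed.

Lemma V_sub_J f : V f -> J f.
Proof. by apply: in_ideal_sub => g Vg; apply: in_ideal1; left. Qed.

Lemma K_mul_J f : K f -> J (mon zs * f).
Proof.
by apply: in_ideal_mull => g Kg; apply: in_ideal1; right; exists g; rewrite prod_zs.
Qed.

Lemma face_ideal_sub_J f : I f -> J f.
Proof. by move/face_ideal_sub_V/V_sub_J. Qed.

Lemma V_K_mul_ys f : V f -> K f -> I (mon ys * f).
Proof.
move=> /in_Igen V_f /in_Igen K_f; apply/in_face_ideal => // mu face_mu.
have [le_mu|ndiv] := boolP (mnm_seq m.+1 ys <= mu)%MM; last by rewrite mcoeffXM_eq0.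
move: face_mu; rewrite -(submK le_mu) addmC mcoeffXM; move: (mu - _)%MM => nu.
have ys_nu i : i \in ys -> mnm_supp (mnm_seq m.+1 ys + nu) i.
  by move=> i_ys; rewrite mnm_suppD mnm_supp_seq ?i_ys // (allP ys_in).
have le_nu p q : (nspread (mnm_supp nu) p q <= nspread (mnm_supp (mnm_seq m.+1 ys + nu)) p q)%N.
  by apply: leq_nspread => i -> nu_i; rewrite mnm_suppD nu_i orbT.
move=> face_nu; apply: memN_msupp_eq0; apply: contraL face_nu => f_nu.
apply: nonface_colon => //; rewrite ?ys_nu ?inE ?eqxx ?orbT //.
  by apply: leq_trans (le_nu _ _); apply: V_f => //; lia.
by apply: leq_trans (le_nu _ _); apply: K_f => //; lia.
Qed.

Lemma phi_rel_unique u p p' : phi u p -> phi u p' -> I (p - p').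
Proof.
move=> /phi_relP[v [w [i [Vv Kw Ii -> ->]]]] /phi_relP[v' [w' [i' [Vv' Kw' Ii' eq_u ->]]]].
have zs_out t z : spread_seq a.-1 2 m.-2 t -> (m < z)%N -> z \notin t.
  by move=> t_spread lt_z; rewrite (spread_seq_notin t_spread) // /within; lia.
have V_sqfree : sqfree_family m.+1 (spread_seq a.-1 2 m.-2).
  by apply: spread_seq_sqfree; lia.
have : V (mon zs * (w - w')).
  have -> : mon zs * (w - w') = v' - v + (i' - i).
    have -> : mon zs * (w - w') = v + mon zs * w + i - (v + mon zs * w' + i) by ring.
    by rewrite eq_u; ring.
  apply: in_idealD; first exact: in_idealB.
  by apply: face_ideal_sub_V; apply: in_idealB.
rewrite -prod_zs -mulrA -mulrBr => V_zs; apply: V_K_mul_ys; last exact: in_idealB.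
apply/in_IgenE/(sqfree_ideal_regular (z := m.+2) V_sqfree) => // [|t /zs_out->//|].
  by rewrite /within; lia.
apply/(sqfree_ideal_regular (z := m.+1) V_sqfree) => // [|t /zs_out->//|].
  by rewrite /within; lia.
exact/in_IgenE.
Qed.

Definition J_seq (s : seq nat) : Prop :=
  spread_seq a.-1 2 m.-2 s \/ exists2 t, spread_seq a.-2 3 (m - 3) t & s = zs ++ t.

Lemma J_seq_within s : J_seq s -> all (within 1 m.+2) s.
Proof.
case=> [s_spread|[t t_spread ->]].
  by apply: spread_seq_all_within s_spread _ _; lia.
by rewrite all_cat (spread_seq_all_within t_spread) //= /within; lia.
Qed.

Lemma J_seq_mon s : J_seq s -> J (mon s).
Proof.
rewrite -prod_xvar; case=> [s_spread|[t t_spread ->]].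
  by apply: V_sub_J; apply: in_ideal1; apply/IgenP/prod_gensI.
rewrite big_cat prod_xvar; apply: K_mul_J; apply: in_ideal1.
exact/IgenP/prod_gensI.
Qed.

Lemma face_J_seq s t (mu : 'X_{1..m.+2}) : J_seq s -> s = t \/ s = zs ++ t ->
  standard (mnm_seq m.+1 s + mu) = face a m (adjoin (mnm_supp mu) t).
Proof.
move=> /J_seq_within s_in def_s; apply: face_mnm_seqD => // i i_in.
case: def_s => -> //; rewrite mem_cat; have -> // : (i \in zs) = false.
by rewrite !inE; move: i_in; rewrite /within; lia.
Qed.

Lemma face_J_avoiding mu i : standard mu -> (2 <= i <= m.-2)%N ->
  ~~ mnm_supp mu i ->
  exists s, [/\ J_seq s, i \notin s & standard (mnm_seq m.+1 s + mu)].
Proof.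
move=> face_mu i_in mu_i.
have [t [i_t [t_spread|t_spread] face_t]] := face_extend_avoiding a_ge3 m_gt face_mu i_in mu_i.
  have J_t : J_seq t by left.
  by exists t; rewrite (face_J_seq (t := t)) //; left.
have J_t : J_seq (zs ++ t) by right; exists t.
exists (zs ++ t); rewrite (face_J_seq (t := t)) //; last by right.
by rewrite mem_cat negb_or i_t !inE; split=> //; move: i_in; lia.
Qed.

Section Homomorphism.
Variable psi : R -> R.
Hypothesis psi_lin : forall r u v, J u -> J v -> I (psi (r * u + v) - (r * psi u + psi v)).
Hypothesis psi_I : forall u, I u -> I (psi u).

Lemma hom_scale r u : J u -> I (psi (r * u) - r * psi u).
Proof.
move=> Ju; have J0 : J 0 by apply: in_ideal0.
have I0 : I (psi 0) by apply: psi_I; apply: in_ideal0.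
by have := in_idealD (psi_lin r Ju J0) I0; rewrite addr0 opprD addrA subrK.
Qed.

Lemma hom_add u v : J u -> J v -> I (psi (u + v) - (psi u + psi v)).
Proof. by move=> Ju Jv; have := psi_lin 1 Ju Jv; rewrite !mul1r. Qed.

Lemma hom_multiple_ideal (G : R -> Prop) (e q : R) :
  (forall g, G g -> J (e * g) /\ I (psi (e * g) - q * g)) ->
  forall f, in_ideal G f -> I (psi (e * f) - q * f).
Proof.
move=> G_psi f Gf; suff [] : J (e * f) /\ I (psi (e * f) - q * f) by [].
elim/in_ideal_ind: f / Gf => [|f g [Jf If] [Jg Ig]|r g /G_psi[Jg Ig]].
- rewrite !mulr0 subr0; split; first exact: in_ideal0.
  by apply: psi_I; apply: in_ideal0.
- rewrite !mulrDr; split; first exact: in_idealD.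
  have := in_idealD (hom_add Jf Jg) (in_idealD If Ig).
  by congr I; ring.
- rewrite !(mulrCA _ r); split; first exact: in_idealM.
  have := in_idealD (hom_scale r Jg) (in_idealM r Ig).
  by congr I; ring.
Qed.

Lemma hom_colon u v : J u -> J v -> I (v * psi u - u * psi v).
Proof.
move=> Ju Jv; have := in_idealB (hom_scale u Jv) (hom_scale v Ju).
by congr I; rewrite [v * u]mulrC; ring.
Qed.

Lemma hom_coef_supp s mu i : J_seq s -> standard mu ->
  (psi (mon s))@_mu != 0 -> i \in s -> (2 <= i <= m.-2)%N -> mnm_supp mu i.
Proof.
move=> J_s face_mu psi_mu i_s i_in; apply/negPn/negP => mu_i.
have [s' [J_s' i_s' face_s']] := face_J_avoiding face_mu i_in mu_i.
have ss'_colon := hom_colon (J_seq_mon J_s) (J_seq_mon J_s').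
have := colon_support m_gt1 m_le ss'_colon (J_seq_within J_s') _ face_s' psi_mu i_s.
by rewrite (negPf i_s') (negPf mu_i) => /(_ (allP (J_seq_within J_s) i i_s)).
Qed.

Lemma hom_V_multiple : exists alpha : R, forall t, spread_seq a.-1 2 m.-2 t ->
  I (psi (mon t) - alpha * mon t).
Proof.
apply: (@glue_multiples k a m m.+1 m_gt1 m_le a.-1 2 m.-2 [::] [::]
  (fun t => psi (mon t))) => //.
- by lia.
- move=> t mu t_spread face_mu psi_mu.
  have [|uniq_t t_in] := @spread_seq_sqfree m.+1 a.-1 2 m.-2 isT _ t t_spread; first lia.
  rewrite mnm_seq_le //; apply/allP => i i_t.
  apply: (hom_coef_supp _ face_mu psi_mu i_t); first by left.
  exact: spread_seq_within t_spread i_t.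
- by move=> t t' t_spread t'_spread; apply: hom_colon; apply: J_seq_mon; left.
- by move=> c; apply: face_connected_V.
Qed.

Hypothesis psi_V : forall t, spread_seq a.-1 2 m.-2 t -> I (psi (mon t)).

Lemma hom_coef_ys s mu : J_seq s -> standard mu -> (psi (mon s))@_mu != 0 ->
  all (mnm_supp mu) ys.
Proof.
move=> J_s face_mu psi_mu; rewrite /= andbT; apply/negPn/negP.
case/(face_extend a_ge3 m_gt face_mu) => t t_spread face_t.
have J_t : J_seq t by left.
have I_psi : I (mon t * psi (mon s)).
  have st_colon := hom_colon (J_seq_mon J_s) (J_seq_mon J_t).
  have := in_idealD st_colon (in_idealM (mon s) (psi_V t_spread)).
  by rewrite subrK.
move: I_psi => /(in_face_ideal _ _ m_gt1 m_le)/(_ (mnm_seq m.+1 t + mu)%MM).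
rewrite (face_J_seq (t := t)) // 1?mcoeffXM; last by left.
by move=> /(_ face_t)/eqP; rewrite (negPf psi_mu).
Qed.

Lemma hom_K_multiple : exists beta : R, forall t, spread_seq a.-2 3 (m - 3) t ->
  I (psi (mon (zs ++ t)) - beta * mon (ys ++ t)).
Proof.
have J_zs t : spread_seq a.-2 3 (m - 3) t -> J_seq (zs ++ t) by right; exists t.
apply: (@glue_multiples k a m m.+1 m_gt1 m_le a.-2 3 (m - 3) ys zs
  (fun t => psi (mon (zs ++ t)))) => //.
- by lia.
- by rewrite /= /within; lia.
- move=> t mu t_spread face_mu psi_mu.
  have t_in := spread_seq_within t_spread.
  rewrite mnm_seq_le.
  + rewrite all_cat (hom_coef_ys (J_zs t t_spread)) //; apply/allP => i i_t.
    apply: (hom_coef_supp (J_zs t t_spread) face_mu psi_mu).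
      by rewrite mem_cat i_t orbT.
    by have := t_in i i_t; lia.
  + rewrite cat_uniq (spread_seq_uniq t_spread) andbT.
    apply/andP; split; first by rewrite /= !inE; lia.
    by apply/hasPn => i /t_in i_in; rewrite !inE; lia.
  + by rewrite all_cat ys_in; apply: spread_seq_all_within t_spread _ _; lia.
- by move=> t t' t_spread t'_spread; apply: hom_colon; apply: J_seq_mon; apply: J_zs.
- by move=> c; apply: face_connected_K => //;
    rewrite mnm_suppD mnm_supp_seq ?(allP ys_in) ?inE ?eqxx ?orbT.
Qed.

End Homomorphism.

Lemma hom_generated (psi : R -> R) :
  (forall r u v, J u -> J v -> I (psi (r * u + v) - (r * psi u + psi v))) ->
  (forall u, I u -> I (psi u)) ->
  exists alpha beta : R, forall u p, phi u p -> I (psi u - (alpha * u + beta * p)).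
Proof.
move=> psi_lin psi_I.
have [alpha psi_V] := hom_V_multiple psi_lin psi_I.
have [|u Iu||beta psi_K] := @hom_K_multiple (fun u => psi u - alpha * u).
- move=> r u v Ju Jv; have := psi_lin r u v Ju Jv.
  by congr I; ring.
- by apply: in_idealB; [apply: psi_I|apply: in_idealM].
- exact: psi_V.
exists alpha, beta => u p /phi_relP[v [w [i [Vv Kw Ii -> ->]]]].
have I_v : I (psi v - alpha * v).
  have := hom_multiple_ideal psi_lin psi_I (e := 1) (q := alpha) _ Vv; rewrite mul1r; apply.
  move=> g /IgenP[t t_spread ->]; rewrite mul1r prod_xvar; split; last exact: psi_V.
  by apply: J_seq_mon; left.
have I_w : I (psi (mon zs * w) - (alpha * mon zs + beta * mon ys) * w).
  apply: (hom_multiple_ideal psi_lin psi_I) Kw => g /IgenP[t t_spread ->].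
  rewrite prod_xvar mulrDl -!mulrA -!mpolyXD -!mnm_seq_cat opprD addrA.
  by split; [apply: J_seq_mon; right; exists t|apply: psi_K].
have J_w := K_mul_J Kw; have J_i := face_ideal_sub_J Ii; have J_v := V_sub_J Vv.
have := in_idealD (in_idealD (hom_add psi_lin (in_idealD J_v J_w) J_i) (hom_add psi_lin J_v J_w))
  (in_idealD (in_idealD I_v I_w) (in_idealB (psi_I _ Ii) (in_idealM alpha Ii))).
by congr I; ring.
Qed.

End Hom.

(** * The unprojection ideal *)

Section KillVariable.
Variables (k : fieldType) (n : nat) (z : 'I_n).

Definition kill_var : {mpoly k[n]} -> {mpoly k[n]} :=
  comp_mpoly [tuple if i == z then 0 else 'X_i | i < n].

HB.instance Definition _ := GRing.RMorphism.on kill_var.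

Lemma kill_varX i : kill_var 'X_i = if i == z then 0 else 'X_i.
Proof. by rewrite /kill_var comp_mpolyXU -tnth_nth tnth_mktuple. Qed.

Lemma kill_var_mod f : exists g, f = kill_var f + 'X_z * g.
Proof.
rewrite (mpolyE f).
apply: (big_ind (fun f => exists g, f = kill_var f + 'X_z * g)) => [|f1 f2|mu _].
- by exists 0; rewrite rmorph0 mulr0 addr0.
- by move=> [g1 def1] [g2 def2]; exists (g1 + g2); rewrite {1}def1 {1}def2 rmorphD mulrDr addrACA.
have [mu0|mu_gt0] := posnP (mu z).
  exists 0; rewrite mulr0 addr0 /kill_var comp_mpolyZ comp_mpolyX; congr (_ *: _).
  rewrite mpolyXE_id; apply: eq_bigr => i _; rewrite tnth_mktuple.
  by case: eqP => // ->; rewrite mu0 !expr0.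
have -> : 'X_[mu] = 'X_z * 'X_[mu - U_(z)] :> {mpoly k[n]}.
  by rewrite -mpolyXD addmC submK //; apply/mnm_lepP => i; rewrite mnm1E; case: eqP => // <-.
exists (f@_mu *: 'X_[mu - U_(z)]).
by rewrite scalerAr rmorphM /= kill_varX eqxx mul0r add0r.
Qed.

End KillVariable.

Section UnprojectionRegular.
Variables (T : comNzRingType) (rho : {rmorphism T -> T}) (GM GK : T -> Prop) (z s y : T).
Local Notation M := (in_ideal GM).
Local Notation K := (in_ideal GK).
Hypothesis rho_mod : forall f, exists g, f = rho f + z * g.
Hypotheses (rho_z : rho z = 0) (rho_y : rho y = y).
Hypotheses (rho_M : forall g, GM g -> rho g = g) (rho_K : forall g, GK g -> rho g = g).
Hypothesis M_regular : forall f, M (z * f) -> M f.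
Hypothesis colon : forall w, M (y * w) -> M (s * w).

(* Applying [rho] to [z * f = g + (z * s - y) * w] gives [y * rho w = rho g] in
   [M], whence [z * s * rho w] is in [M]; and [w - rho w] is in [z * K]. *)
Lemma unprojection_regular f :
  (exists g w, [/\ M g, K w & z * f = g + (z * s - y) * w]) ->
  exists g w, [/\ M g, K w & f = g + (z * s - y) * w].
Proof.
move=> [g [w [Mg Kw def_zf]]].
have M_rho h : M h -> M (rho h).
  by apply: in_ideal_morph => h' Gh'; rewrite rho_M //; apply: in_ideal1.
have [w1 Kw1 def_w] : exists2 w1, K w1 & w = rho w + z * w1.
  elim/in_ideal_ind: w / {Mg def_zf} Kw => [|w w' [v Kv def_w] [v' Kv' def_w']|r h Gh].
  - by exists 0; [apply: in_ideal0|rewrite rmorph0 mulr0 addr0].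
  - exists (v + v'); first exact: in_idealD.
    by rewrite {1}def_w {1}def_w' rmorphD mulrDr addrACA.
  - have [r1 def_r] := rho_mod r; exists (r1 * h); first exact: in_ideal_gen.
    by rewrite {1}def_r rmorphM /= (rho_K Gh) mulrDl mulrA.
have M_yw : M (y * rho w).
  have /eqP := congr1 rho def_zf.
  rewrite !(rmorphM, rmorphB, rmorphD) /= rho_z rho_y !mul0r sub0r mulNr eq_sym subr_eq0.
  by move=> /eqP <-; apply: M_rho.
have M_f : M (f - (z * s - y) * w1).
  apply: M_regular; have -> : z * (f - (z * s - y) * w1) = g + z * (s * rho w) - y * rho w.
    by rewrite mulrBr def_zf {1}def_w; ring.
  by apply: in_idealB => //; apply: in_idealD => //; apply/in_idealM/colon.
by exists (f - (z * s - y) * w1), w1; split; rewrite ?subrK.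
Qed.

End UnprojectionRegular.

HB.instance Definition _ (k : fieldType) (m : nat) := GRing.RMorphism.copy (@embRP k m)
  (comp_mpoly [tuple 'X_(widen_ord (leqnSn m.+2) i) | i < m.+2]).

Lemma embRP_prod (k : fieldType) m s : all (within 1 m.+2) s ->
  embRP (\prod_(i <- s) xvar k m.+1 i) = \prod_(i <- s) xvar k m.+2 i.
Proof.
move=> /allP s_in; rewrite rmorph_prod; apply: eq_big_seq => i /s_in i_in /=.
rewrite /embRP /xvar comp_mpolyXU -tnth_nth tnth_mktuple; congr 'X_ _.
by apply/val_inj; rewrite /= !inordK; move: i_in; rewrite /within; lia.
Qed.

Lemma embRP_ideal (k : fieldType) m (D : seq nat -> Prop) f : sqfree_family m.+1 D ->
  in_ideal (prod_gens (xvar k m.+1) D) f ->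
  in_ideal (prod_gens (xvar k m.+2) D) (embRP f).
Proof.
move=> D_sqfree; apply: in_ideal_morph => _ [s Ds ->]; apply: in_ideal1.
have [_ s_in] := D_sqfree s Ds.
by rewrite /= embRP_prod //; apply: prod_gensI.
Qed.

Section Unprojection.
Variables (k : fieldType) (a m : nat).
Hypotheses (a_ge3 : (3 <= a)%N) (m_gt : (a.*2 < m)%N).
Local Notation x := (xvar k m.+2).
Local Notation ys := [:: 1; m.-1; m]%N.
Local Notation y := (\prod_(i <- ys) x i).
Local Notation z1 := (x m.+1).
Local Notation z2 := (x m.+2).
Local Notation T := (x m.+3).

Local Notation V := (in_ideal (prod_gens x (spread_seq a.-1 2 m.-2))).
Local Notation K := (in_ideal (prod_gens x (spread_seq a.-2 3 (m - 3)))).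

Definition base_family (s : seq nat) : Prop :=
  min_nonface a m s \/ exists2 t, spread_seq a.-1 2 m.-2 t & s = m.+3 :: t.

Local Notation M := (in_ideal (prod_gens x base_family)).

Let V_sqfree N : (m <= N.+1)%N -> sqfree_family N (spread_seq a.-1 2 m.-2).
Proof. by move=> m_le; apply: spread_seq_sqfree; lia. Qed.

Let K_sqfree N : (m <= N.+1)%N -> sqfree_family N (spread_seq a.-2 3 (m - 3)).
Proof. by move=> m_le; apply: spread_seq_sqfree; lia. Qed.

(* Modulo [z1] the binomials [(z1 * (T * z2) - y) * w] reduce to monomials. *)
Definition limit_family (s : seq nat) : Prop :=
  base_family s \/ exists2 t, spread_seq a.-2 3 (m - 3) t & s = ys ++ t.

Lemma limit_familyP s : limit_family s ->
  [/\ s != [::], uniq s & all (fun i => within 1 m i || (i == m.+3)) s].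
Proof.
have low t n p q : spread_seq n p q t -> (0 < p)%N -> (q <= m)%N ->
    all (fun i => within 1 m i || (i == m.+3)) t.
  move=> t_spread p_gt0 q_le; have := spread_seq_all_within t_spread p_gt0 q_le.
  by apply: sub_all => i ->.
case=> [[[s_spread|[t t_spread ->]]|[t t_spread ->]]|[t t_spread ->]].
- split; [|exact: spread_seq_uniq s_spread|by apply: low s_spread _ _; lia].
  by rewrite -size_eq0 (size_spread_seq s_spread); lia.
- rewrite /= inE !(spread_seq_notin t_spread) ?(spread_seq_uniq t_spread);
    [|by rewrite /within; lia..].
  by rewrite (low t _ _ _ t_spread) //; [split; rewrite /within; lia|lia].
- rewrite /= (spread_seq_notin t_spread) ?(spread_seq_uniq t_spread); last by rewrite /within; lia.
  by rewrite eqxx orbT (low t _ _ _ t_spread) //; lia.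
- rewrite /= !inE !(spread_seq_notin t_spread) ?(spread_seq_uniq t_spread);
    [|by rewrite /within; lia..].
  by rewrite (low t _ _ _ t_spread) //; [split; rewrite /within; lia|lia].
Qed.

Lemma limit_sqfree : sqfree_family m.+2 limit_family.
Proof.
move=> s /limit_familyP[_ -> s_in]; split=> //.
by apply: sub_all s_in => i; rewrite /within; lia.
Qed.

Lemma limit_notin s z : limit_family s -> (m < z < m.+3)%N -> z \notin s.
Proof.
move=> /limit_familyP[_ _ /allP s_in] z_in; apply: contraL z_in => /s_in.
by rewrite /within; lia.
Qed.

Lemma base_sqfree : sqfree_family m.+2 base_family.
Proof. by move=> s s_base; apply: limit_sqfree; left. Qed.

Lemma Sgens_base g : M g -> in_ideal (@Sgens k a m) g.
Proof.
apply: in_ideal_sub => _ [s [s_nonface|[t t_spread ->]] ->].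
  by apply: in_ideal1; left; apply/IgensP/prod_gensI.
have t_in : all (within 1 m.+2) t by apply: spread_seq_all_within t_spread _ _; lia.
apply: in_ideal1; right; exists (\prod_(i <- t) xvar k m.+1 i), 0; split.
  apply/phi_relP; exists (\prod_(i <- t) xvar k m.+1 i), 0, 0.
  rewrite !mulr0 !addr0; split=> //; try exact: in_ideal0.
  exact/in_ideal1/IgenP/prod_gensI.
by rewrite rmorph0 subr0 embRP_prod // big_cons.
Qed.

Lemma Sgens_binomial w : K w -> in_ideal (@Sgens k a m) ((z1 * (T * z2) - y) * w).
Proof.
apply: in_ideal_mull => _ [t t_spread ->]; apply: in_ideal1; right.
have t_in : all (within 1 m.+2) t by apply: spread_seq_all_within t_spread _ _; lia.
pose w0 := \prod_(i <- t) xvar k m.+1 i.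
exists (\prod_(i <- [:: m.+1; m.+2]) xvar k m.+1 i * w0), (\prod_(i <- ys) xvar k m.+1 i * w0).
split.
  apply/phi_relP; exists 0, w0, 0; rewrite !prod_xvar add0r addr0.
  split=> //; try exact: in_ideal0.
  exact/in_ideal1/IgenP/prod_gensI.
rewrite !rmorphM /= !embRP_prod //; [|by rewrite /= /within; lia..].
by rewrite !big_cons !big_nil; rewrite -[TP k m]/T; ring.
Qed.

Lemma base_mulT v : V v -> M (T * v).
Proof.
apply: in_ideal_mull => _ [t t_spread ->].
by apply: in_ideal1; exists (m.+3 :: t); [right; exists t|rewrite big_cons].
Qed.

Lemma SgensP f : in_ideal (@Sgens k a m) f <-> exists g w,
  [/\ M g, K w & f = g + (z1 * (T * z2) - y) * w].
Proof.
split=> [|[g [w [Mg Kw ->]]]]; last first.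
  by apply: in_idealD; [apply: Sgens_base|apply: Sgens_binomial].
elim/in_ideal_ind: f / => [|f f' [g [w [Mg Kw ->]]] [g' [w' [Mg' Kw' ->]]]|r f S_f].
- by exists 0, 0; rewrite mulr0 addr0; split=> //; apply: in_ideal0.
- by exists (g + g'), (w + w'); split; [exact: in_idealD|exact: in_idealD|ring].
suff [g [w [Mg Kw ->]]] : exists g w, [/\ M g, K w & f = g + (z1 * (T * z2) - y) * w].
  by exists (r * g), (r * w); split; [exact: in_idealM|exact: in_idealM|ring].
case: S_f => [/IgensP[s s_nonface ->]|[u [p [/phi_relP[v [w [i [Vv Kw Ii -> ->]]]] ->]]]].
  exists (\prod_(j <- s) x j), 0; rewrite mulr0 addr0; split=> //; last exact: in_ideal0.
  by apply: in_ideal1; exists s => //; left.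
have M_Tv : M (T * embRP v).
  by apply: base_mulT; apply: embRP_ideal; [apply: V_sqfree; lia|apply/in_IgenE].
have M_i : M (embRP i).
  have : in_ideal (prod_gens x (min_nonface a m)) (embRP i).
    by apply: embRP_ideal; [apply: min_nonface_sqfree; lia|apply/in_IgensE].
  by apply: in_ideal_sub => _ [s s_nonface ->]; apply/in_ideal1/prod_gensI; left.
have K_w : K (embRP w) by apply: embRP_ideal; [apply: K_sqfree; lia|apply/in_IgenE].
exists (T * embRP v + T * embRP i), (embRP w); split=> //.
  by apply: in_idealD => //; apply: in_idealM.
rewrite !(rmorphD, rmorphM) /= -!prod_xvar !embRP_prod; [|by rewrite /= /within; lia..].
by rewrite !big_cons !big_nil -[TP k m]/T; ring.
Qed.

Lemma base_colon_y w : M (y * w) -> V w.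
Proof.
rewrite prod_xvar => /(in_sqfree_ideal _ base_sqfree) yw_div.
apply/in_IgenE/in_Igen => // [|mu w_mu]; first lia.
have [|s s_base s_supp] := yw_div (mnm_seq m.+2 ys + mu)%MM.
  by rewrite mcoeff_msupp mcoeffXM -mcoeff_msupp.
suff -> : nspread (mnm_supp mu) 2 m.-2 = nspread (mnm_supp (mnm_seq m.+2 ys + mu)) 2 m.-2.
  case: s_base s_supp => [s_nonface|[t t_spread ->] /= /andP[_]] s_supp.
    by apply: (@nonface_nspread a m); apply/nonfaceP; exists s.
  by apply/nspread_geP; exists t.
apply: eq_nspread => i i_in; rewrite mnm_suppD mnm_supp_seq.
- by have -> // : (i \in ys) = false; rewrite !inE; move: i_in; rewrite /within; lia.
- by rewrite /= /within; lia.
- by move: i_in; rewrite /within; lia.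
Qed.

Lemma z1_regular f : in_ideal (@Sgens k a m) (z1 * f) -> in_ideal (@Sgens k a m) f.
Proof.
move=> /SgensP S_zf; apply/SgensP.
have z_in : within 1 m.+3 m.+1 by rewrite /within; lia.
have kill_x i : within 1 m.+3 i -> i != m.+1 -> kill_var (inord m) (x i) = x i.
  move=> i_in ne_i; rewrite /xvar kill_varX ifN //; apply: contra ne_i => /eqP eq_i.
  by rewrite (ix_inj i_in z_in eq_i).
have kill_prod s : all (within 1 m.+3) s -> m.+1 \notin s ->
    kill_var (inord m) (\prod_(i <- s) x i) = \prod_(i <- s) x i.
  move=> /allP s_in s_z; rewrite rmorph_prod; apply: eq_big_seq => i i_s.
  by apply: kill_x; [apply: s_in|apply: contraNneq s_z => <-].
apply: (@unprojection_regular _ (kill_var (inord m : 'I_m.+3))) S_zf.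
- exact: kill_var_mod.
- by rewrite /= /xvar kill_varX eqxx.
- by apply: kill_prod; rewrite /= ?inE /within; lia.
- move=> _ [s s_base ->]; apply: kill_prod; first by have [] := base_sqfree s_base.
  by apply: limit_notin; [left|lia].
- move=> _ [s s_spread ->]; apply: kill_prod.
    by apply: spread_seq_all_within s_spread _ _; lia.
  by rewrite (spread_seq_notin s_spread) // /within; lia.
- move=> g; apply: sqfree_ideal_regular => // s s_base.
    exact: base_sqfree.
  by apply: limit_notin; [left|lia].
- by move=> w /base_colon_y/base_mulT Tw; rewrite -mulrA mulrCA; apply: in_idealM.
Qed.

Definition limit_with (zs s : seq nat) : Prop :=
  limit_family s \/ exists2 z, z \in zs & s = [:: z].

Lemma limit_with_sqfree zs : {subset zs <= [:: m.+1; m.+2]} ->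
  sqfree_family m.+2 (limit_with zs).
Proof.
move=> zs_sub s [s_limit|[z /zs_sub z_zs ->]]; first exact: limit_sqfree.
rewrite /= andbT; split=> //; move: z_zs.
by rewrite !inE /within => /orP[] /eqP ->; lia.
Qed.

Lemma Sgens_limit zs f : m.+1 \in zs ->
  in_ideal (gen_union (@Sgens k a m) [seq x i | i <- zs]) f <->
  in_ideal (prod_gens x (limit_with zs)) f.
Proof.
move=> z1_zs; pose SZ := in_ideal (gen_union (@Sgens k a m) [seq x i | i <- zs]).
have S_SZ g : in_ideal (@Sgens k a m) g -> SZ g.
  by apply: in_ideal_sub => h Sh; apply: in_ideal1; left.
have Z_SZ z : z \in zs -> SZ (x z) by move=> z_zs; apply: in_ideal1; right; apply: map_f.
have Z_limit z : z \in zs -> in_ideal (prod_gens x (limit_with zs)) (x z).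
  by move=> z_zs; apply: in_ideal1; exists [:: z]; [right; exists z|rewrite big_seq1].
split; apply: in_ideal_sub => g; last first.
  case=> s [[s_base|[t t_spread ->]]|[z z_zs ->]] ->; last by rewrite big_seq1; apply: Z_SZ.
    by apply/S_SZ/Sgens_base/in_ideal1; exists s.
  have K_t : K (\prod_(i <- t) x i) by apply/in_ideal1/prod_gensI.
  have := in_idealB (in_idealM (T * z2 * \prod_(i <- t) x i) (Z_SZ _ z1_zs))
    (S_SZ _ (Sgens_binomial K_t)).
  by congr in_ideal; rewrite big_cat /=; ring.
case=> [Sg|/mapP[z z_zs ->]]; last exact: Z_limit.
have /SgensP[h [w [Mh Kw ->]]] := in_ideal1 Sg.
rewrite mulrBl addrA; apply: in_idealB; first apply: in_idealD.
- by apply: in_ideal_sub Mh => _ [s s_base ->]; apply/in_ideal1/prod_gensI; left; left.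
- by rewrite -mulrA mulrC; apply/in_idealM/Z_limit.
- apply: in_ideal_mull Kw => _ [t t_spread ->]; rewrite -big_cat /=; apply/in_ideal1/prod_gensI.
  by left; right; exists t.
Qed.

Lemma S_regular : regular_seq (@Sgens k a m) [:: z1P k m; z2P k m].
Proof.
have S_nil f : in_ideal (gen_union (@Sgens k a m) [::]) f <-> in_ideal (@Sgens k a m) f.
  by apply: eq_in_ideal => g; split=> [[]|] //; left.
split=> [[|[|//]] _ f|] /=.
- by move/S_nil/z1_regular/S_nil.
- rewrite -[[:: z1P k m]]/[seq x i | i <- [:: m.+1]] !Sgens_limit ?mem_head //.
  rewrite -[z2P k m]/z2; apply: sqfree_ideal_regular => [||s [s_limit|[z]]].
  + by apply: limit_with_sqfree => z; rewrite !inE => ->.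
  + by rewrite /within; lia.
  + by apply: limit_notin s_limit _; lia.
  + by rewrite inE => /eqP -> ->; rewrite inE; lia.
- rewrite -[[:: z1P k m; z2P k m]]/[seq x i | i <- [:: m.+1; m.+2]] Sgens_limit ?mem_head //.
  have zs_sqfree := @limit_with_sqfree [:: m.+1; m.+2] (fun _ => id).
  move=> /(in_sqfree_ideal _ zs_sqfree)/(_ 0%MM); rewrite msupp1 inE eqxx => /(_ isT)[[|i s]].
    by case=> [/limit_familyP[]|[]].
  by rewrite /= /mnm_supp mnm0E.
Qed.

End Unprojection.

(** * Faces of the cyclic polytope *)

Lemma lagrange_coef (F : fieldType) n (x : nat -> F) (p : {poly F}) :
  injective x -> (size p <= n.+1)%N ->
  p`_n = \sum_(i < n.+1) p.[x i] / \prod_(j < n.+1 | j != i) (x i - x j).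
Proof.
move=> inj_x sz_p; rewrite {1}(lagrange_gen (ltn0Sn n) inj_x sz_p) coef_sum.
apply: eq_bigr => i _; rewrite lagrangeE // coefCM coefCM horner_prod.
rewrite (eq_bigr (fun j : 'I_n.+1 => x i - x j)) => [|j _]; last by rewrite hornerXsubC.
congr (_ * _); rewrite -[RHS]mulr1; congr (_ * _).
have /monicP : \prod_(j < n.+1 | j != i) ('X - (x j)%:P) \is monic by apply: monic_prod_XsubC.
rewrite lead_coefE -big_filter size_prod_XsubC size_filter -sum1_count big_filter /=.
by rewrite sum1_card cardC1 card_ord.
Qed.

Section Alternation.
Variable R : realFieldType.

Lemma sum_ltn_ord n k : (\sum_(l < n) (k < l)%N)%N = (n - k.+1)%N.
Proof. by elim: n => [|n IHn]; rewrite ?big_ord0 // big_ord_recr /= IHn; lia. Qed.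

Lemma sign_prod_sub n (x : nat -> R) (i : 'I_n.+1) :
  {homo x : i j / (i < j)%N >-> i < j} ->
  0 < (-1) ^+ (n - i) * \prod_(j < n.+1 | j != i) (x i - x j).
Proof.
move=> x_inc; have -> : (-1) ^+ (n - i) = \prod_(j < n.+1 | j != i) (-1) ^+ (i < j)%N :> R.
  rewrite -(big_morph _ (exprD (-1)) (expr0 (-1))); congr (_ ^+ _).
  by have := sum_ltn_ord n.+1 i; rewrite (bigD1 i) //= ltnn add0n => ->; rewrite subSS.
rewrite -big_split; apply: prodr_gt0 => j ne_ji /=.
have [lt_ij|lt_ji|/val_inj eq_ij] := ltngtP i j; last by rewrite eq_ij eqxx in ne_ji.
  by rewrite expr1 mulN1r opprB subr_gt0; apply: x_inc.
by rewrite expr0 mul1r subr_gt0; apply: x_inc.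
Qed.

Lemma sorted_extension (l : seq R) : sorted <%R l ->
  exists2 x : nat -> R, {homo x : i j / (i < j)%N >-> i < j}
                      & forall i, (i < size l)%N -> x i = l`_i.
Proof.
move=> l_sorted; pose x i := nth (last 0 l + i%:R) l i.
have x_l i : (i < size l)%N -> x i = l`_i by move=> lt_i; apply: set_nth_default.
have x_out i : (size l <= i)%N -> x i = last 0 l + i%:R by apply: nth_default.
exists x => // i j lt_ij; have [lt_j|le_j] := ltnP j (size l).
  rewrite !x_l ?(ltn_trans lt_ij) //.
  by apply: (sorted_ltn_nth lt_trans) => //; rewrite inE (ltn_trans lt_ij).
rewrite (x_out j) //; have [lt_i|le_i] := ltnP i (size l); last first.
  by rewrite x_out // ltrD2l ltr_nat.
have l_gt0 : (0 < size l)%N by apply: leq_ltn_trans lt_i.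
rewrite x_l //; apply: (@le_lt_trans _ _ (last 0 l)); last first.
  by rewrite ltrDl ltr0n (leq_ltn_trans _ lt_ij).
rewrite -nth_last; have [->//|ne_i] := eqVneq i (size l).-1.
apply/ltW/(sorted_ltn_nth lt_trans) => //; rewrite ?inE ?ltn_predL //.
by rewrite ltn_neqAle ne_i -ltnS prednK.
Qed.

Lemma alternation (l : seq R) (p : {poly R}) : sorted <%R l -> (size p < size l)%N ->
  (forall i, (i < size l)%N -> 0 <= (-1) ^+ i * p.[l`_i]) -> p = 0.
Proof.
move=> l_sorted; have [x x_inc x_l] := sorted_extension l_sorted.
case sz_l: (size l) => [//|n]; rewrite ltnS => sz_p p_alt.
have inj_x : injective x.
  move=> i j eq_x; have [lt|lt|//] := ltngtP i j;
  by have := x_inc _ _ lt; rewrite eq_x ltxx.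
have term_ge0 (i : 'I_n.+1) :
    0 <= (-1) ^+ n * (p.[x i] / \prod_(j < n.+1 | j != i) (x i - x j)).
  have := p_alt i (ltn_ord i); rewrite -x_l ?sz_l //.
  have := sign_prod_sub i x_inc; set c := \prod_(_ | _) _ => c_sign p_i.
  have -> : (-1) ^+ n * (p.[x i] / c) = ((-1) ^+ i * p.[x i]) / ((-1) ^+ (n - i) * c).
    have -> : (-1) ^+ n = (-1) ^+ i * (-1) ^+ (n - i) :> R by rewrite -exprD subnKC // -ltnS.
    by rewrite invfM -exprVn invrN1 mulrACA.
  by apply: divr_ge0; rewrite // ltW.
have p_x (i : 'I_n.+1) : p.[x i] = 0.
  have := lagrange_coef inj_x (leqW sz_p); rewrite nth_default //.
  move/(congr1 ( *%R ((-1) ^+ n))); rewrite mulr0 mulr_sumr => /esym/eqP.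
  rewrite psumr_eq0 // => /allP/(_ i); rewrite mem_index_enum => /(_ isT)/=.
  rewrite !mulf_eq0 signr_eq0 invr_eq0 /= => /orP[/eqP //|/eqP c0].
  by have := sign_prod_sub i x_inc; rewrite c0 mulr0 ltxx.
apply: (@roots_geq_poly_eq0 _ p l); rewrite ?sz_l ?(leqW sz_p) //.
  apply/(all_nthP 0) => i; rewrite sz_l => lt_i; rewrite rootE -x_l ?sz_l //.
  exact/eqP/(p_x (Ordinal lt_i)).
exact: lt_sorted_uniq.
Qed.

Lemma nonneg_alternating_zeros (b : bool) (l : seq R) (p : {poly R}) :
  sorted <%R l -> (size p < size l)%N -> (forall u, u \in l -> 0 <= p.[u]) ->
  (forall i, (i < size l)%N -> odd i = b -> p.[l`_i] = 0) -> p = 0.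
Proof.
move=> l_sorted sz_p p_ge0 p_zero.
suff /eqP : (-1) ^+ (~~ b) *: p = 0 by rewrite scaler_eq0 signr_eq0 => /eqP.
apply: (@alternation l); rewrite ?size_scale ?signr_eq0 // => i lt_i; rewrite hornerZ.
have [eq_b|ne_b] := eqVneq (odd i) b; first by rewrite p_zero // !mulr0.
rewrite mulrA -signr_odd -signr_addb.
have -> : odd i (+) ~~ b = false by case: (odd i) (b) ne_b => [] [].
by rewrite mul1r p_ge0 ?mem_nth.
Qed.

End Alternation.

Definition doubled (s : seq nat) : seq nat := flatten [seq [:: i; i.+1] | i <- s].

Lemma size_doubled s : size (doubled s) = (size s).*2.
Proof. by elim: s => //= i s ->. Qed.

Lemma nth_doubled_even s i : nth 0%N (doubled s) i.*2 = nth 0%N s i.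
Proof. by elim: s i => [|j s IHs] [|i] //=; rewrite ?nth_nil // IHs. Qed.

Lemma doubled_within n p q s : spread_seq n p q s -> all (within p q.+1) (doubled s).
Proof.
move=> s_spread; apply/allP => i /flattenP[_ /mapP[j /(spread_seq_within s_spread) j_in ->]].
by rewrite !inE /within => /orP[] /eqP ->; lia.
Qed.

Lemma doubled_increasing n p q s : spread_seq n p q s -> pairwise ltn (doubled s).
Proof.
elim: s n p => //= i s IHs [//|n] p; rewrite spread_seq_cons => /andP[_ s_spread].
rewrite ltnSn (IHs _ _ s_spread) andbT /=.
have lt_s := doubled_within s_spread.
by apply/andP; split; apply: sub_all lt_s => j; rewrite /within /=; lia.
Qed.

Section Exposed.
Variables (R : realFieldType) (n : nat) (T : nat -> R).
Hypothesis T_inc : {in within 1 n &, {homo T : i j / (i < j)%N >-> i < j}}.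

(* The points [(T i, ..., T i ^+ c)] with [i] in [W] are those lying on a
   supporting hyperplane of [(T 1, ..., T 1 ^+ c)], ..., [(T n, ..., T n ^+ c)];
   a hyperplane amounts to a polynomial of degree at most [c]. *)
Definition exposed (c : nat) (W : pred nat) : Prop :=
  exists2 p : {poly R}, (size p <= c.+1)%N &
    forall i, within 1 n i -> 0 <= p.[T i] /\ (p.[T i] == 0) = W i.

Let T_le : {in within 1 n &, {mono T : i j / (i <= j)%N >-> i <= j}}.
Proof. exact: le_mono_in T_inc. Qed.

Let T_eq : {in within 1 n &, forall i j, (T i == T j) = (i == j)}.
Proof. by move=> i j i_in j_in; apply: (inj_in_eq (inc_inj_in T_le)). Qed.

Lemma sub_exposed c c' (W W' : pred nat) : (c <= c')%N ->
  (forall i, within 1 n i -> W i = W' i) -> exposed c W -> exposed c' W'.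
Proof.
move=> le_c eqW [p sz_p p_W]; exists p; first exact: leq_trans sz_p _.
by move=> i i_in; rewrite -eqW //; apply: p_W.
Qed.

Lemma exposedU c c' (W W' : pred nat) :
  exposed c W -> exposed c' W' -> exposed (c + c') (predU W W').
Proof.
move=> [p sz_p p_W] [q sz_q q_W']; exists (p * q).
  by apply: leq_trans (size_polyMleq _ _) _; lia.
move=> i i_in; have [p_ge0 p_i] := p_W i i_in; have [q_ge0 q_i] := q_W' i i_in.
by rewrite hornerM mulf_eq0 p_i q_i mulr_ge0.
Qed.

Lemma exposed0 : exposed 0 pred0.
Proof. by exists 1 => [|i _]; rewrite ?size_poly1 // hornerE ler01 oner_eq0. Qed.

Lemma exposed_first : exposed 1 (pred1 1%N).
Proof.
exists ('X - (T 1)%:P) => [|i i_in]; first by rewrite size_XsubC.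
have one_in : within 1 n 1 by move: i_in; rewrite /within; lia.
by rewrite hornerXsubC subr_ge0 subr_eq0 T_eq // T_le //; case/andP: i_in.
Qed.

Lemma exposed_last : exposed 1 (pred1 n).
Proof.
exists ((T n)%:P - 'X) => [|i i_in]; first by rewrite -opprB size_polyN size_XsubC.
have n_in : within 1 n n by move: i_in; rewrite /within; lia.
rewrite -opprB hornerN hornerXsubC opprB subr_ge0 subr_eq0 eq_sym T_eq // T_le //.
by case/andP: i_in.
Qed.

Lemma exposed_pair j j' : (j <= j' <= j.+1)%N -> within 1 n j -> within 1 n j' ->
  exposed 2 (pred2 j j').
Proof.
move=> adjacent j_in j'_in; exists (('X - (T j)%:P) * ('X - (T j')%:P)) => [|i i_in].
  by apply: leq_trans (size_polyMleq _ _) _; rewrite !size_XsubC.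
rewrite hornerM !hornerXsubC mulf_eq0 !subr_eq0 !T_eq //; split=> //.
have [le_ij|lt_ji] := leqP i j.
  by apply: mulr_le0; rewrite subr_le0 T_le //; lia.
by apply: mulr_ge0; rewrite subr_ge0 T_le //; lia.
Qed.

Lemma exposed_if (b : bool) c (W : pred nat) : exposed c W -> exposed (b * c) (fun i => b && W i).
Proof. by case: b; rewrite ?mul1n ?mul0n //= => _; apply: exposed0. Qed.

Lemma exposed_interval (W : pred nat) p q : (0 < p)%N -> (q <= n)%N ->
  exposed (nspread W p q).*2 (predI (within p q) W).
Proof.
move=> + q_le; move: p; apply: (left_end_ind (q := q)) => [p lt_qp|p le_pq IHp1 IHp2] p_gt0.
  rewrite nspread_gt //; apply: sub_exposed exposed0 => // i _ /=.
  by rewrite /within; lia.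
rewrite nspread_left //; case: ifP => Wp; last first.
  apply: sub_exposed (IHp1 isT) => // i _ /=; rewrite /within.
  by have [->|ne_ip] := eqVneq i p; [rewrite Wp !andbF|congr andb; lia].
pose p' := if (p < q)%N && W p.+1 then p.+1 else p.
have p'_le : (p <= p' <= p.+1)%N && (p' <= q)%N by rewrite /p'; case: ifP; lia.
have pp' : exposed 2 (pred2 p p') by apply: exposed_pair; rewrite /within; lia.
apply: sub_exposed (exposedU pp' (IHp2 isT)) => // i _ /=; rewrite /within.
have [->|ne_ip] := eqVneq i p; first by rewrite Wp leqnn le_pq.
have [->|ne_ip1] := eqVneq i p.+1; first by rewrite /p'; case: ifP; lia.
have -> : (i == p') = false by lia.
by congr andb; lia.
Qed.

Variable a : nat.
Hypotheses (a_ge3 : (3 <= a)%N) (n_gt : (a.*2.+1 < n)%N).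

Lemma face_narrow (W : pred nat) : W 1%N -> W n -> face a n W ->
  (nspread W 2 n.-2 <= a.-2)%N \/ (nspread W 3 n.-1 <= a.-2)%N.
Proof.
move=> W1 Wn faceW; have [i i_in Wi] := face_1m_missing a_ge3 (ltnW n_gt) W1 Wn faceW.
have /andP[i_ge i_le] := i_in; have i_gt0 : (0 < i)%N by lia.
have /andP[lt_from2] := faceW; rewrite W1 Wn /= => lt_from3.
have := nspread_gap W (p := 2) (i := i.-1) (j := i.+1) (q := n.-1).
have := nspread_gap W (p := 3) (i := i.-1) (j := i.+1) (q := n.-2).
have := nspread_leftS W 2 i.-1; have := nspread_rightS W i.+1 n.-1.
have := nspread_splitN 2 n.-2 i_gt0 Wi; have := nspread_splitN 3 n.-1 i_gt0 Wi.
lia.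
Qed.

Lemma face_exposed (W : pred nat) : face a n W -> exposed a.*2.-1 W.
Proof.
move=> faceW; have /andP[lt_from2 lt_from3] := faceW.
have [W1n|W1n] := boolP (W 1%N && W n); last first.
  apply: sub_exposed (exposedU (exposed_if (W 1%N) exposed_first) (exposedU
    (exposed_if (W n) exposed_last) (exposed_interval W (p := 2) isT (leq_pred n)))).
    by case: (W 1%N) (W n) W1n => [] []; lia.
  move=> i i_in /=; rewrite /within.
  have [->|ne_i1] := eqVneq i 1%N; first by case: (W 1%N); lia.
  have [->|ne_in] := eqVneq i n; first by case: (W n); lia.
  by rewrite !andbF; move: i_in; rewrite /within; case: (W i); lia.
have /andP[W1 Wn] := W1n.
have [narrow|narrow] := face_narrow W1 Wn faceW.
- have n1_gt0 : (0 < n.-1)%N by lia.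
  apply: sub_exposed (exposedU exposed_first (exposedU
    (exposed_interval W (p := 2) (q := n.-2) isT _) (exposed_interval W n1_gt0 (leqnn n)))).
  + by have := @nspread_short W n.-1 n; lia.
  + move=> i i_in /=; rewrite /within.
    have [->|ne_i1] := eqVneq i 1%N; first by rewrite W1.
    by move: i_in; rewrite /within; case: (W i); lia.
  + by lia.
- apply: sub_exposed (exposedU exposed_last (exposedU
    (exposed_interval W (p := 1) (q := 2) isT _)
    (exposed_interval W (p := 3) (q := n.-1) isT (leq_pred n)))).
  + by have := @nspread_short W 1 2; lia.
  + move=> i i_in /=; rewrite /within.
    have [->|ne_i1] := eqVneq i n; first by rewrite Wn.
    by move: i_in; rewrite /within; case: (W i); lia.
  + by lia.
Qed.

Lemma nonneg_alternating_zeros_nat (b : bool) (l : seq nat) (p : {poly R}) :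
  pairwise ltn l -> all (within 1 n) l -> (size p < size l)%N ->
  (forall i, within 1 n i -> 0 <= p.[T i]) ->
  (forall i, (i < size l)%N -> odd i = b -> p.[T (nth 0%N l i)] = 0) -> p = 0.
Proof.
move=> l_inc l_in sz_p p_ge0 p_zero.
apply: (@nonneg_alternating_zeros _ b (map T l)); rewrite ?size_map //.
- by apply: homo_sorted_in T_inc l_in _; rewrite sorted_pairwise //; apply: ltn_trans.
- by move=> _ /mapP[i /(allP l_in) i_in ->]; apply: p_ge0.
- by move=> i lt_i /(p_zero i lt_i); rewrite (nth_map 0%N).
Qed.

Section NonnegZeros.
Variable p : {poly R}.
Hypotheses (sz_p : (size p <= a.*2)%N) (p_ge0 : forall i, within 1 n i -> 0 <= p.[T i]).

Let zero_doubled s i : {in s, forall j, p.[T j] = 0} -> (i < (size s).*2)%N ->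
  odd i = false -> p.[T (nth 0%N (doubled s) i)] = 0.
Proof.
move=> s_zero lt_i even_i; rewrite -(odd_double_half i) even_i nth_doubled_even.
by apply/s_zero/mem_nth; lia.
Qed.

Lemma nonneg_inner_zeros s : spread_seq a 2 n.-1 s -> {in s, forall i, p.[T i] = 0} -> p = 0.
Proof.
move=> s_spread s_zero; apply: (@nonneg_alternating_zeros_nat true (1%N :: doubled s)) => //.
- rewrite pairwise_cons (doubled_increasing s_spread) andbT.
  by apply: sub_all (doubled_within s_spread) => i /andP[].
- by rewrite /= (sub_all _ (doubled_within s_spread)) => [|i]; rewrite /within; lia.
- by rewrite /= size_doubled (size_spread_seq s_spread) ltnS.
- by move=> [|i] //=; rewrite ltnS size_doubled => lt_i /negbTE odd_i; apply: zero_doubled.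
Qed.

Lemma nonneg_end_zeros t : spread_seq a.-1 3 n.-2 t ->
  {in [:: 1; n]%N ++ t, forall i, p.[T i] = 0} -> p = 0.
Proof.
move=> t_spread t_zero; pose s := 1%N :: t.
have s_spread : spread_seq a 1 n.-2 s.
  rewrite -(prednK (_ : 0 < a)%N) ?spread_seq_cons ?t_spread; last lia.
  by rewrite /within; lia.
apply: (@nonneg_alternating_zeros_nat false (rcons (doubled s) n)) => //.
- rewrite pairwise_rcons (doubled_increasing s_spread) andbT.
  by apply: sub_all (doubled_within s_spread) => i /andP[_] /=; lia.
- by rewrite all_rcons (sub_all _ (doubled_within s_spread)) => [|i]; rewrite /within; lia.
- by rewrite size_rcons size_doubled (size_spread_seq s_spread) ltnS.
- move=> i; rewrite size_rcons size_doubled ltnS leq_eqVlt nth_rcons size_doubled.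
  case/predU1P => [->|lt_i] even_i.
    by rewrite ltnn eqxx t_zero // !inE eqxx orbT.
  rewrite lt_i zero_doubled // => j; rewrite inE => j_s; apply: t_zero.
  by rewrite !inE; case/predU1P: j_s => ->; rewrite ?orbT.
Qed.

End NonnegZeros.

Lemma exposed_face (W : pred nat) i : within 1 n i -> ~~ W i -> exposed a.*2.-1 W -> face a n W.
Proof.
move=> i_in Wi [p sz_p p_W].
have p_ge0 j : within 1 n j -> 0 <= p.[T j] by case/p_W.
have p_zero j : within 1 n j -> W j -> p.[T j] = 0 by move=> /p_W[_ <-] /eqP.
have {}sz_p : (size p <= a.*2)%N by lia.
apply: contraNT Wi => /nonfaceP[s s_nonface /allP Ws].
suff p0 : p = 0 by have [_ <-] := p_W i i_in; rewrite p0 horner0.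
have s_zero : {in s, forall j, p.[T j] = 0}.
  move=> j j_s; apply: p_zero; last exact: Ws.
  by apply: (allP (min_nonface_within _ s_nonface)) => //; lia.
case: s_nonface s_zero => [s_spread|[t t_spread ->]].
  exact: nonneg_inner_zeros.
exact: nonneg_end_zeros.
Qed.

End Exposed.

Section CyclicPolytope.
Variables (R : realFieldType) (d n : nat) (t : 'I_n.+1 -> R).
Implicit Type W : {set 'I_n.+1}.

(* Vertices of the polytope are renumbered from 1. *)
Definition vertices W : pred nat := fun i => inord i.-1 \in W.

Let T (i : nat) : R := t (inord i.-1).

Let T_ord (i : 'I_n.+1) : T i.+1 = t i. Proof. by rewrite /T /= inord_val. Qed.

Let vertices_ord W (i : 'I_n.+1) : vertices W i.+1 = (i \in W).
Proof. by rewrite /vertices /= inord_val. Qed.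

Lemma hyperplane_exposed (c : 'I_d -> R) (b : R) W :
  (forall i, \sum_(j < d) c j * t i ^+ j.+1 <= b) ->
  W = [set i | \sum_(j < d) c j * t i ^+ j.+1 == b] -> exposed n.+1 T d (vertices W).
Proof.
move=> le_b ->; exists (b%:P - \sum_(j < d) c j *: 'X^(j.+1)) => [|i _].
  rewrite (leq_trans (size_polyD _ _)) // size_polyN geq_max size_polyC.
  rewrite (leq_trans (leq_b1 _)) // (leq_trans (size_sum _ _ _)) //.
  by apply/bigmax_leqP => j _; rewrite (leq_trans (size_scale_leq _ _)) // size_polyXn ltnS.
have -> : (b%:P - \sum_(j < d) c j *: 'X^(j.+1)).[T i] = b - \sum_(j < d) c j * T i ^+ j.+1.
  rewrite hornerD hornerN hornerC horner_sum; congr (_ - _).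
  by apply: eq_bigr => j _; rewrite hornerZ hornerXn.
by rewrite subr_ge0 subr_eq0 /vertices inE eq_sym; split=> //; apply: le_b.
Qed.

Lemma exposed_hyperplane W : exposed n.+1 T d (vertices W) ->
  exists (c : 'I_d -> R) (b : R),
    (forall i, \sum_(j < d) c j * t i ^+ j.+1 <= b) /\
    W = [set i | \sum_(j < d) c j * t i ^+ j.+1 == b].
Proof.
move=> [p sz_p p_W]; exists (fun j => - p`_j.+1), p`_0.
have pE i : \sum_(j < d) - p`_j.+1 * t i ^+ j.+1 = p`_0 - p.[t i].
  rewrite (horner_coef_wide _ sz_p) big_ord_recl expr0 mulr1 opprD addrA subrr sub0r.
  by rewrite -sumrN; apply: eq_bigr => j _; rewrite mulNr.
have p_t i : 0 <= p.[t i] /\ (p.[t i] == 0) = (i \in W).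
  by rewrite -T_ord -vertices_ord; apply: p_W; rewrite /within ltn_ord.
split=> [i|]; first by rewrite pE gerBl; case: (p_t i).
apply/setP => i; rewrite inE pE -subr_eq0 addrAC subrr sub0r oppr_eq0.
by case: (p_t i).
Qed.

End CyclicPolytope.

Section CyclicComplex.
Variables (k : fieldType) (R : realType) (a m : nat) (t : 'I_m.+1 -> R).
Hypotheses (a_ge3 : (3 <= a)%N) (m_gt : (a.*2 < m)%N).
Hypothesis t_inc : forall i j : 'I_m.+1, (i < j)%N -> t i < t j.
Local Notation d := a.*2.-1.

Let T_inc : {in within 1 m.+1 &, {homo (fun i => t (inord i.-1)) : i j / (i < j)%N >-> i < j}}.
Proof.
move=> i j; rewrite !unfold_in => /andP[i_gt0 i_le] /andP[j_gt0 j_le] lt_ij.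
by apply: t_inc; rewrite !inordK; lia.
Qed.

Let n_gt : (a.*2.+1 < m.+1)%N. Proof. by []. Qed.

Lemma cyc_faceP (W : {set 'I_m.+1}) : cyc_face d t W <-> face a m.+1 (vertices W).
Proof.
split=> [[->|[c [b [le_b def_W proper_W]]]]|face_W].
- have nspread0 p q : nspread (vertices (set0 : {set 'I_m.+1})) p q = 0%N.
    by rewrite -(nspread_pred0 p q); apply: eq_nspread => i _; rewrite /vertices inE.
  by apply: face_small; rewrite nspread0; lia.
- have /forallPn[i W_i] : ~~ [forall i, i \in W].
    by apply: contra proper_W => /forallP W_all; apply/eqP/setP => i; rewrite inE W_all.
  apply: (exposed_face T_inc a_ge3 n_gt (i := i.+1)); first by rewrite /within ltn_ord.
    by rewrite /vertices /= inord_val.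
  exact: hyperplane_exposed le_b def_W.
right; have [c [b [le_b def_W]]] := exposed_hyperplane (face_exposed T_inc a_ge3 n_gt face_W).
exists c, b; split=> //; apply/negP => /eqP W_all; have /andP[lt_from2 _] := face_W.
have : (m.+1 - 2 <= (nspread (vertices W) 2 m).*2)%N.
  by apply: nspread_full => i _; rewrite /vertices W_all inE.
by move: lt_from2 => /=; lia.
Qed.

Definition vertex_seq (W : {set 'I_m.+1}) : seq nat := [seq (i : 'I_m.+1).+1 | i <- enum W].

Lemma nonface_vertex_seq (mu : 'X_{1..m.+1}) : ~~ face a m.+1 (mnm_supp mu) <->
  exists2 W, ~ cyc_face d t W & all (mnm_supp mu) (vertex_seq W).
Proof.
split=> [nonface|[W W_nonface /allP supp_W]].
  pose W := [set i | (0 < mu i)%N].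
  have eq_face : face a m.+1 (vertices W) = face a m.+1 (mnm_supp mu).
    by apply: eq_face => // i _; rewrite /vertices inE.
  exists W; first by move/cyc_faceP; rewrite eq_face (negPf nonface).
  apply/allP => _ /mapP[i + ->]; rewrite mem_enum inE.
  by rewrite /mnm_supp /= inord_val.
apply/negP => face_mu; apply: W_nonface; apply/cyc_faceP; apply: face_sub face_mu => // i.
move=> /andP[i_gt0 i_le] W_i; apply: supp_W; apply/mapP; exists (inord i.-1).
  by rewrite mem_enum.
by rewrite inordK prednK.
Qed.

Lemma in_SRgensE f :
  in_ideal (@SRgens k R d m.+1 t) f <-> in_ideal (prod_gens (xvar k m) (min_nonface a m.+1)) f.
Proof.
have SRgensP g : @SRgens k R d m.+1 t g <->
    prod_gens (xvar k m) (fun s => exists2 W, ~ cyc_face d t W & s = vertex_seq W) g.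
  have prodE W : \prod_(i <- vertex_seq W) xvar k m i = \prod_(i in W) 'X_i.
    by rewrite big_map big_enum; apply: eq_bigr => i _; rewrite /xvar inord_val.
  split=> [[W [W_nonface ->]]|[s [W W_nonface ->] ->]]; last by exists W; rewrite prodE.
  by exists (vertex_seq W); [exists W|rewrite prodE].
rewrite (eq_in_ideal SRgensP) in_sqfree_ideal; last first.
  move=> _ [W _ ->]; rewrite map_inj_uniq ?enum_uniq; last by move=> i j [] /val_inj.
  by split=> //; apply/allP => _ /mapP[i _ ->]; rewrite /within /= ltn_ord.
rewrite in_sqfree_ideal; last by apply: min_nonface_sqfree; lia.
split=> f_div mu /f_div => [[_ [W W_nonface ->] supp_W]|/nonfaceP/nonface_vertex_seq].
  by apply/nonfaceP/nonface_vertex_seq; exists W.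
by case=> W W_nonface supp_W; exists (vertex_seq W) => //; exists W.
Qed.

End CyclicComplex.

(** * The isomorphism *)

Lemma spread_seq_last n p q s : (0 < p)%N -> spread_seq n p q s ->
  spread_seq n p q.-1 s \/ exists2 t, spread_seq n.-1 p (q - 2) t & s = rcons t q.
Proof.
move=> p_gt0; case/lastP: s => [|t i] s_spread; first by left.
have := size_spread_seq s_spread; rewrite size_rcons => def_n.
rewrite -def_n spread_seq_rcons // in s_spread *; case/andP: s_spread => i_in t_spread.
have [def_i|ne_i] := eqVneq i q; first by right; exists t; rewrite -def_i.
by left; rewrite spread_seq_rcons // t_spread andbT; move: i_in; rewrite /within; lia.
Qed.

Section LinearForms.
Variables (k : fieldType) (n : nat).

Lemma linformX (i : 'I_n) : linform ('X_i : {mpoly k[n]}).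
Proof. by rewrite /linform msuppX /= mdeg1. Qed.

Lemma linform0 : linform (0 : {mpoly k[n]}).
Proof. by rewrite /linform msupp0. Qed.

End LinearForms.

Section Substitution.
Variables (k : fieldType) (N n : nat) (f : nat -> {mpoly k[n]}).

Definition subst_tuple : N.+1.-tuple {mpoly k[n]} := [tuple f i.+1 | i < N.+1].

Lemma comp_xvar i : within 1 N.+1 i -> xvar k N i \mPo subst_tuple = f i.
Proof.
by move=> /andP[i_gt0 i_le]; rewrite comp_mpolyXU -tnth_nth tnth_mktuple inordK prednK.
Qed.

Lemma comp_prod_xvar s : all (within 1 N.+1) s ->
  (\prod_(i <- s) xvar k N i) \mPo subst_tuple = \prod_(i <- s) f i.
Proof.
move=> /allP s_in; rewrite rmorph_prod; apply: eq_big_seq => i /s_in.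
exact: comp_xvar.
Qed.

End Substitution.

Section Relabelling.
Variable m : nat.

(* Variable [m] becomes the last vertex [m.+1], and [T], of index [m.+3],
   becomes the vertex [m]. *)
Definition relabel (i : nat) : nat :=
  if i == m then m.+1 else if i == m.+3 then m else i.

Definition unlabel (i : nat) : nat :=
  if i == m then m.+3 else if i == m.+1 then m else i.

Lemma relabelK : {in within 1 m.+1, cancel unlabel relabel}.
Proof.
move=> i; rewrite unfold_in /within /unlabel => i_in.
have [->|ne_im] := eqVneq i m; [|have [->|ne_im1] := eqVneq i m.+1];
  by rewrite /relabel; do ?case: eqP; lia.
Qed.

Lemma unlabelK i : (i \notin [:: m.+1; m.+2]) -> (i <= m.+3)%N -> unlabel (relabel i) = i.
Proof.
rewrite !inE negb_or /relabel => i_out i_le.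
have [->|ne_im] := eqVneq i m; [|have [->|ne_im3] := eqVneq i m.+3];
  by rewrite /unlabel; do ?case: eqP; lia.
Qed.

Lemma unlabel_range i : (0 < m)%N -> within 1 m.+1 i ->
  within 1 m.+3 (unlabel i) /\ unlabel i \notin [:: m.+1; m.+2].
Proof. by move=> m_gt0; rewrite !inE /within /unlabel; do ?case: eqP; lia. Qed.

Lemma relabel_low n p q t : spread_seq n p q t -> (q < m)%N -> map relabel t = t.
Proof.
move=> t_spread q_lt; rewrite map_id_in // => i /(spread_seq_within t_spread).
by rewrite /relabel; do ?case: eqP; lia.
Qed.

Lemma unlabel_low n p q t : spread_seq n p q t -> (q < m)%N -> map unlabel t = t.
Proof.
move=> t_spread q_lt; rewrite map_id_in // => i /(spread_seq_within t_spread).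
by rewrite /unlabel; do ?case: eqP; lia.
Qed.

Variable a : nat.
Hypotheses (a_ge3 : (3 <= a)%N) (m_gt : (a.*2 < m)%N).

Let relabel_at : [/\ relabel 1 = 1, relabel m.-1 = m.-1, relabel m = m.+1 & relabel m.+3 = m]%N.
Proof. by rewrite /relabel eqxx; split; do ?case: eqP; lia. Qed.

Let unlabel_at : [/\ unlabel 1 = 1, unlabel m.-1 = m.-1, unlabel m = m.+3 & unlabel m.+1 = m]%N.
Proof. by rewrite /unlabel eqxx; split; do ?case: eqP; lia. Qed.

Lemma relabel_limit s : limit_family a m s ->
  exists2 s', min_nonface a m.+1 s' & perm_eq s' (map relabel s).
Proof.
have [lab1 labm1 labm labT] := relabel_at.
case=> [[[s_spread|[t t_spread ->]]|[t t_spread ->]]|[t t_spread ->]].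
- exists s; first by left; apply: spread_seq_widen s_spread _ _; lia.
  by rewrite (relabel_low s_spread) //; lia.
- exists ([:: 1; m.+1]%N ++ t).
    by right; exists t; rewrite // (spread_seq_widen t_spread) //=; lia.
  by rewrite /= lab1 labm (relabel_low t_spread) //; lia.
- exists (rcons t m); last by rewrite /= labT (relabel_low t_spread) ?perm_rcons //; lia.
  left; rewrite -(prednK (_ : 0 < a)%N) ?spread_seq_rcons //; last by lia.
  by rewrite /within /= (spread_seq_widen t_spread) //; lia.
- exists ([:: 1; m.+1]%N ++ rcons t m.-1).
    right; exists (rcons t m.-1) => //.
    rewrite -(prednK (_ : 0 < a.-1)%N) ?spread_seq_rcons //; last by lia.
    by rewrite /within /= (spread_seq_widen t_spread) //; lia.
  rewrite /= lab1 labm1 labm (relabel_low t_spread); last by lia.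
  by rewrite perm_cons -rcons_cons perm_rcons.
Qed.

Lemma unlabel_nonface s : min_nonface a m.+1 s ->
  exists2 s', limit_family a m s' & perm_eq s' (map unlabel s).
Proof.
have [lab1 labm1 labm labm_1] := unlabel_at.
case=> [s_spread|[t t_spread ->]].
  have [low|[u u_spread ->]] := spread_seq_last (p := 2) isT s_spread.
    exists s; first by left; left; left.
    by rewrite (unlabel_low low) //=; lia.
  exists (m.+3 :: u).
    by left; right; exists u; rewrite // (spread_seq_widen u_spread) //=; lia.
  by rewrite map_rcons labm (unlabel_low u_spread) 1?perm_sym ?perm_rcons //=; lia.
have [low|[u u_spread ->]] := spread_seq_last (p := 3) isT t_spread.
  exists ([:: 1; m]%N ++ t); first by left; left; right; exists t.
  by rewrite /= lab1 labm_1 (unlabel_low low) //=; lia.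
exists ([:: 1; m.-1; m]%N ++ u).
  by right; exists u; rewrite // (spread_seq_widen u_spread) //=; lia.
rewrite /= lab1 labm_1 map_rcons labm1 (unlabel_low u_spread) /=; last by lia.
by rewrite perm_cons -rcons_cons perm_sym perm_rcons.
Qed.

End Relabelling.

Section Isomorphism.
Variables (k : fieldType) (a m : nat).
Hypotheses (a_ge3 : (3 <= a)%N) (m_gt : (a.*2 < m)%N).
Local Notation x := (xvar k m.+2).
Local Notation y := (xvar k m).
Local Notation zs := [:: m.+1; m.+2].

Definition toSR (i : nat) : {mpoly k[m.+1]} := if i \in zs then 0 else y (relabel m i).

Definition ofSR (i : nat) : {mpoly k[m.+3]} := x (unlabel m i).

Local Notation to_tuple := (subst_tuple m.+2 toSR).
Local Notation of_tuple := (subst_tuple m ofSR).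

Lemma limit_to_SR f : in_ideal (prod_gens x (limit_with a m zs)) f ->
  in_ideal (prod_gens y (min_nonface a m.+1)) (f \mPo to_tuple).
Proof.
apply: (in_ideal_morph (h := comp_mpoly to_tuple)) => _ [s s_limit ->] /=.
have [_ s_in] := limit_with_sqfree a_ge3 m_gt (fun _ => id) s_limit.
rewrite comp_prod_xvar //; case: s_limit => [s_limit|[z z_zs ->]]; last first.
  by rewrite big_seq1 /toSR z_zs; apply: in_ideal0.
have [s' s'_nonface perm_s'] := relabel_limit a_ge3 m_gt s_limit.
have -> : \prod_(i <- s) toSR i = \prod_(i <- s') y i.
  rewrite (perm_big _ perm_s') big_map; apply: eq_big_seq => i i_s.
  rewrite /toSR ifN // !inE; apply/negP => z_i.
  by have := limit_notin a_ge3 m_gt s_limit (z := i); rewrite i_s; case/orP: z_i => /eqP ->; lia.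
exact/in_ideal1/prod_gensI.
Qed.

Lemma SR_to_limit f : in_ideal (prod_gens y (min_nonface a m.+1)) f ->
  in_ideal (prod_gens x (limit_with a m zs)) (f \mPo of_tuple).
Proof.
apply: (in_ideal_morph (h := comp_mpoly of_tuple)) => _ [s s_nonface ->] /=.
rewrite comp_prod_xvar; last by apply: min_nonface_within s_nonface; lia.
have [s' s'_limit perm_s'] := unlabel_nonface a_ge3 m_gt s_nonface.
rewrite -(big_map (unlabel m) predT x) -(perm_big _ perm_s').
by apply/in_ideal1/prod_gensI; left.
Qed.

Lemma S_graded_iso (R : realType) (t : 'I_m.+1 -> R) :
  (forall i j : 'I_m.+1, (i < j)%N -> t i < t j) ->
  graded_iso (gen_union (@Sgens k a m) [:: z1P k m; z2P k m]) (@SRgens k R a.*2.-1 m.+1 t).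
Proof.
move=> t_inc; rewrite -[[:: z1P k m; z2P k m]]/[seq x i | i <- zs].
have S_limit f : in_ideal (gen_union (@Sgens k a m) [seq x i | i <- zs]) f <->
    in_ideal (prod_gens x (limit_with a m zs)) f.
  by apply: Sgens_limit; rewrite ?mem_head.
have SR_E f := @in_SRgensE k R a m t a_ge3 m_gt t_inc f.
exists to_tuple, of_tuple; split.
- split=> i; rewrite tnth_mktuple /toSR /ofSR; last exact: linformX.
  by case: ifP => _; [apply: linform0|apply: linformX].
- by move=> f /S_limit/limit_to_SR/SR_E.
- by move=> f /SR_E/SR_to_limit/S_limit.
- move=> i; rewrite tnth_mktuple S_limit.
  have -> : 'X_i = x i.+1 by rewrite /xvar /= inord_val.
  have i_le := ltn_ord i; rewrite /toSR; case: ifPn => [i_zs|i_zs].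
    rewrite comp_mpoly0 subr0; apply: in_ideal1; exists [:: i.+1]; rewrite ?big_seq1 //.
    by right; exists i.+1.
  rewrite comp_xvar; first by rewrite /ofSR unlabelK // subrr; apply: in_ideal0.
  by move: i_zs; rewrite !inE negb_or /relabel /within; do ?case: eqP; lia.
- move=> j; rewrite tnth_mktuple SR_E.
  have -> : 'X_j = y j.+1 by rewrite /xvar /= inord_val.
  have j_in : within 1 m.+1 j.+1 by rewrite /within ltn_ord.
  have [|unlabel_in unlabel_zs] := unlabel_range _ j_in; first by lia.
  by rewrite comp_xvar // /toSR ifN // relabelK // subrr; apply: in_ideal0.
Qed.

End Isomorphism.

Theorem theorem4p4 (k : fieldType) (d m : nat) :
  odd d -> (5 <= d)%N -> (d < m.-1)%N ->
  let a := (d.+1)./2 in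
  let I := in_ideal (Igens (xR k m) a m) in
  let J := in_ideal (Jgens (xR k m) (z1R k m) (z2R k m) a m) in
  let phi := phi_rel (xR k m) (z1R k m) (z2R k m) a m in
  let L := @Sgens k a m in
  [/\ (* I is contained in J *)
      (forall f, I f -> J f),
      (* phi is well defined as a map J/I -> R/I *)
      (forall u p p', phi u p -> phi u p' -> I (p - p')),
      (* Hom_{R/I}(J, R/I) is generated by phi and the inclusion *)
      (forall psi : {mpoly k[m.+2]} -> {mpoly k[m.+2]},
         (forall r u v, J u -> J v -> I (psi (r * u + v) - (r * psi u + psi v))) ->
         (forall u, I u -> I (psi u)) ->
         exists alpha beta : {mpoly k[m.+2]},
           forall u p, phi u p -> I (psi u - (alpha * u + beta * p))),
      (* z1, z2 is an S-regular sequence *)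
      regular_seq L [:: z1P k m; z2P k m]
    & (* S/(z1,z2) is isomorphic to k[Delta(d, m+1)] as graded k-algebras *)
      forall (R : realType) (t : 'I_m.+1 -> R),
        (forall i j : 'I_m.+1, (i < j)%N -> t i < t j) ->
        graded_iso (gen_union L [:: z1P k m; z2P k m]) (@SRgens k R d m.+1 t)].
Proof.
move=> odd_d d_ge5 d_lt a I J phi L.
have def_d : d = a.*2.-1 by rewrite /a; lia.
have a_ge3 : (3 <= a)%N by rewrite /a; lia.
have m_gt : (a.*2 < m)%N by rewrite /a; lia.
split.
- exact: face_ideal_sub_J.
- exact: phi_rel_unique.
- exact: hom_generated.
- exact: S_regular.
- by move=> R t t_inc; rewrite def_d; apply: S_graded_iso.
Qed.
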